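(* Let $a,b\in\mathbb{R}$. Suppose that $S_{ab}$ has irrational rotation number and that $(0,1)$ and $(0,-1)$ lie in the same $T_{ab}$-orbit. Let $\mathcal{O}=\{T_{ab}^{(j)}(\mathbf{v}_0):1\le j\le m\}$ be any finite segment of that orbit which contains all the orbit points strictly between $(0,1)$ and $(0,-1)$ together with whichever of $(0,1)$, $(0,-1)$ occurs later in the orbit. If $J=\mathbb{R}^+[\mathbf{v},\mathbf{v}')$ is a half-open sector with $\mathbf{v},\mathbf{v}'\in\mathcal{O}$ and containing no element of $\mathcal{O}$ in its interior, then the first return map $T_J$ of $T_{ab}$ to $J$ is piecewise linear with exactly two pieces, and the two linear maps $M_1,M_2$ corresponding to the two pieces commute: $M_1M_2=M_2M_1$.
   Context: For real parameters $a,b$, the map $T_{ab}:\mathbb{R}^2\to\mathbb{R}^2$ is $T_{ab}(x,y)=(ax-y,x)$ if $x\ge 0$ and $T_{ab}(x,y)=(bx-y,x)$ if $x<0$; it is a homeomorphism, positively homogeneous of degree one, mapping rays from the origin onto rays from the origin. $T_{ab}^{(j)}$ denotes the $j$-th iterate ($j\in\mathbb{Z}$). $S_{ab}:S^1\to S^1$, $S_{ab}(\mathbf{u})=T_{ab}(\mathbf{u})/|T_{ab}(\mathbf{u})|$, and $r(S_{ab})$ is its Poincaré rotation number (counterclockwise, in full turns). For nonzero $\mathbf{v},\mathbf{v}'$ not on a common ray, the half-open sector $\mathbb{R}^+[\mathbf{v},\mathbf{v}')$ is the set of points $t\mathbf{w}$, $t>0$, with $\mathbf{w}$ ranging over directions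 obtained by going counterclockwise from the direction of $\mathbf{v}$ (included) to the direction of $\mathbf{v}'$ (excluded). The first return map $T_J$ to a sector $J$ sends $\mathbf{w}\in J$ to $T_{ab}^{(k)}(\mathbf{w})$ where $k\ge1$ is minimal with $T_{ab}^{(k)}(\mathbf{w})\in J$. A map on $J$ is piecewise linear with exactly $k$ pieces if $J$ is divided by rays from the origin into $k$ subsectors on each of which it agrees with a linear map, and no coarser such division exists. *)

(* Defs.v *)
From Stdlib Require Import Reals ZArith Lra.
Open Scope R_scope.

Definition vec := (R * R)%type.

Definition vscale (t : R) (p : vec) : vec := (t * fst p, t * snd p).

Definition vnorm (p : vec) : R := sqrt (fst p ^ 2 + snd p ^ 2).

Definition T (a b : R) (p : vec) : vec :=
  let (x, y) := p in
  if Rle_dec 0 x then (a * x - y, x) else (b * x - y, x).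

Definition Tinv (a b : R) (p : vec) : vec :=
  let (u, w) := p in
  if Rle_dec 0 w then (w, a * w - u) else (w, b * w - u).

Fixpoint Tn (a b : R) (n : nat) (p : vec) : vec :=
  match n with O => p | S n => T a b (Tn a b n p) end.

Fixpoint Tinvn (a b : R) (n : nat) (p : vec) : vec :=
  match n with O => p | S n => Tinv a b (Tinvn a b n p) end.

Definition Tz (a b : R) (j : Z) (p : vec) : vec :=
  match j with
  | Z0 => p
  | Zpos k => Tn a b (Pos.to_nat k) p
  | Zneg k => Tinvn a b (Pos.to_nat k) p
  end.

Definition Sab (a b : R) (u : vec) : vec :=
  vscale (/ vnorm (T a b u)) (T a b u).

Definition is_lift (a b : R) (F : R -> R) : Prop :=
  continuity F /\
  forall t : R,
    (cos (2 * PI * F t), sin (2 * PI * F t)) =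
    Sab a b (cos (2 * PI * t), sin (2 * PI * t)).

(* L represents the Poincare rotation number of S_ab (in full turns,
   counterclockwise), i.e. L = lim F^n(0)/n for a lift F; it is
   determined modulo 1. *)
Definition rotation_number (a b L : R) : Prop :=
  exists F : R -> R, is_lift a b F /\
    Un_cv (fun n : nat => Nat.iter n F 0 / INR n) L.

Definition irrational (L : R) : Prop :=
  forall (p : Z) (q : nat), (0 < q)%nat -> L * INR q <> IZR p.

Definition e_up : vec := (0, 1).
Definition e_down : vec := (0, -1).

Definition rot (th : R) (p : vec) : vec :=
  (cos th * fst p - sin th * snd p, sin th * fst p + cos th * snd p).

Definition ccw_angle (v w : vec) (th : R) : Prop :=
  0 <= th < 2 * PI /\ exists t : R, 0 < t /\ w = vscale t (rot th v).

Definition same_ray (v v' : vec) : Prop :=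
  exists t : R, 0 < t /\ v' = vscale t v.

Definition in_sector (v v' p : vec) : Prop :=
  exists th th' : R, ccw_angle v p th /\ ccw_angle v v' th' /\ th < th'.

Definition in_open_sector (v v' p : vec) : Prop :=
  exists th th' : R, ccw_angle v p th /\ ccw_angle v v' th' /\ 0 < th /\ th < th'.

Definition first_return (a b : R) (J : vec -> Prop) (w z : vec) : Prop :=
  exists k : nat, (1 <= k)%nat /\ J (Tn a b k w) /\
    (forall j : nat, (1 <= j < k)%nat -> ~ J (Tn a b j w)) /\
    z = Tn a b k w.

Record mat := Mat { m11 : R; m12 : R; m21 : R; m22 : R }.

Definition mat_apply (M : mat) (p : vec) : vec :=
  (m11 M * fst p + m12 M * snd p, m21 M * fst p + m22 M * snd p).

Definition mat_mul (M N : mat) : mat :=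
  Mat (m11 M * m11 N + m12 M * m21 N) (m11 M * m12 N + m12 M * m22 N)
      (m21 M * m11 N + m22 M * m21 N) (m21 M * m12 N + m22 M * m22 N).

(* Main.v *)
Require Import Defs.
From Stdlib Require Import Reals ZArith.
From Stdlib Require Import Lra Lia Classical.
Open Scope R_scope.

(* Lift S_ab to an increasing map F of the line commuting with t |-> t + 1; irrationality
   of the rotation number makes all orbits of F modulo 1 injective.  Write the ends of J as
   x_p and x_q on the orbit (x_j) of v0, and let n >= 0 be minimal such that x_{-n} is
   interior to J.  Preimages of the ends of J can cut the first return map only at
   x_{-n}, so it is T^(q+n) clockwise of u = T^(-n) v0 and T^(p+n) counterclockwise of it, and
   neither iterate meets the break rays of T before returning.  Hence M2 M1 and M1 M2 are
   the two one-sided derivatives of T^(p+q+2n) at u.  They differ by a product of shears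
   along u, one for each visit of the orbit of u to the y-axis.  There are exactly two
   visits, at (0,1) and at (0,-1), and their shears are inverse to each other. *)

(** * First returns of circle maps to an arc bounded by orbit points *)

(** The given segment may start far from J; prolonging it backwards to u makes both ends of J and
    both points (0,1), (0,-1) forward images of one interior point of J, while the later images of
    u, up to the end of the segment, all stay out of the interior. The order of the two products
    comes from the ends of J. Directions just counterclockwise of u are moved first by M2 and, since
    T^(p+n) u = v, come back just counterclockwise of v, where M1 acts. Directions just clockwise of
    u are moved first by M1 and come back just clockwise of v', where M2 acts. The shears cancel
    only if both visits to the y-axis occur before time p+q+2n. They do: T^(p+q+2n) u is the first
    return of v, it is interior to J, and so it lies beyond the segment. *)

Definition cong (s t : R) : Prop := exists z : Z, s = t + IZR z.

Definition arc (al be t : R) : Prop := exists z : Z, al <= t + IZR z < be.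

Definition open_arc (al be t : R) : Prop := exists z : Z, al < t + IZR z < be.

(** Lifts of orientation-preserving circle homeomorphisms, angles being counted in full turns.
    Monotonicity and surjectivity together give continuity; surjectivity is the form in which points
    of an arc are pulled back. *)
Record circle_lift (F : R -> R) : Prop := {
  lift_incr : forall s t, s < t -> F s < F t;
  lift_shift : forall t z, F (t + IZR z) = F t + IZR z;
  lift_surj : forall y, exists x, F x = y }.

Definition aperiodic (F : R -> R) : Prop :=
  forall k t, (0 < k)%nat -> ~ cong (Nat.iter k F t) t.

Lemma cong_refl s : cong s s.
Proof. exists 0%Z; simpl; lra. Qed.

Lemma cong_sym s t : cong s t -> cong t s.
Proof. intros [z ->]; exists (- z)%Z; rewrite opp_IZR; lra. Qed.

Lemma cong_trans s t r : cong s t -> cong t r -> cong s r.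
Proof. intros [z ->] [z' ->]; exists (z' + z)%Z; rewrite plus_IZR; lra. Qed.

Lemma cong_add s z : cong (s + IZR z) s.
Proof. now exists z. Qed.

Lemma arc_cong al be s t : cong s t -> arc al be s -> arc al be t.
Proof. intros [z ->] [z' H]; exists (z + z')%Z; rewrite plus_IZR; lra. Qed.

Lemma open_arc_cong al be s t : cong s t -> open_arc al be s -> open_arc al be t.
Proof. intros [z ->] [z' H]; exists (z + z')%Z; rewrite plus_IZR; lra. Qed.

Lemma IZR_small z : -1 < IZR z < 1 -> z = 0%Z.
Proof. intros [H1 H2]; apply lt_IZR in H1; apply lt_IZR in H2; lia. Qed.

Lemma cong_close s t : cong s t -> -1 < s - t < 1 -> s = t.
Proof.
  intros [z ->] H; rewrite (IZR_small z) by lra; simpl; lra.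
Qed.

Lemma lift_lt_inv F s t : circle_lift F -> F s < F t -> s < t.
Proof.
  intros HF H; destruct (Rtotal_order s t) as [|[->|h]]; [assumption|lra|].
  apply (lift_incr F HF) in h; lra.
Qed.

Lemma lift_le F s t : circle_lift F -> s <= t -> F s <= F t.
Proof.
  intros HF [h| ->]; [left; now apply lift_incr|lra].
Qed.

Lemma lift_inj F s t : circle_lift F -> F s = F t -> s = t.
Proof.
  intros HF H; destruct (Rtotal_order s t) as [h|[->|h]]; auto;
  apply (lift_incr F HF) in h; lra.
Qed.

Lemma lift_iter F k : circle_lift F -> circle_lift (Nat.iter k F).
Proof.
  intros HF; induction k as [|k [I1 I2 I3]].
  - constructor; simpl; auto; intros y; now exists y.
  - constructor.
    + intros s t h; rewrite !Nat.iter_succ; apply (lift_incr F HF); auto.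
    + intros t z; rewrite !Nat.iter_succ, I2; apply (lift_shift F HF).
    + intros y; destruct (lift_surj F HF y) as [x <-].
      destruct (I3 x) as [x' <-]; now exists x'.
Qed.

Lemma lift_cong F s t : circle_lift F -> cong s t -> cong (F s) (F t).
Proof. intros HF [z ->]; exists z; now apply lift_shift. Qed.

Lemma lift_cong_inv F s t : circle_lift F -> cong (F s) (F t) -> cong s t.
Proof.
  intros HF [z H]; exists z; apply (lift_inj F); auto.
  now rewrite (lift_shift F HF).
Qed.

Lemma aperiodic_index F i j t :
  circle_lift F -> aperiodic F -> cong (Nat.iter i F t) (Nat.iter j F t) -> i = j.
Proof.
  intros HF HA.
  assert (W : forall i j, (i < j)%nat -> ~ cong (Nat.iter i F t) (Nat.iter j F t)).
  { intros i' j' h H; apply (HA (j' - i')%nat t); [lia|].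
    apply cong_sym, (lift_cong_inv (Nat.iter i' F)); [now apply lift_iter|].
    rewrite <- Nat.iter_add; now replace (i' + (j' - i'))%nat with j' by lia. }
  intros H; destruct (Nat.lt_trichotomy i j) as [h|[h|h]]; auto; exfalso.
  - now apply (W i j).
  - apply (W j i); auto; now apply cong_sym.
Qed.

(** If [k <= c], cancelling [k] iterates would put [s] itself among the images of [ga] up to [M],
    and of these only [ga] is in the open arc. Hence a point of the arc that reaches such an image,
    for instance an end of the arc, has first passed through [ga]. *)
Lemma return_index F al be ga M k c s :
  circle_lift F -> be < al + 1 -> al < ga < be ->
  (forall i, (1 <= i <= M)%nat -> ~ open_arc al be (Nat.iter i F ga)) ->
  al < s < be -> s <> ga -> (c <= M)%nat ->
  cong (Nat.iter k F s) (Nat.iter c F ga) ->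
  (c < k)%nat /\ cong (Nat.iter (k - c) F s) ga.
Proof.
  intros HF Hab Hg HM Hs Hsg Hc H.
  destruct (Nat.le_gt_cases k c) as [h|h].
  - exfalso. assert (H' : cong s (Nat.iter (c - k) F ga)).
    { apply (lift_cong_inv (Nat.iter k F)); [now apply lift_iter|].
      rewrite <- Nat.iter_add; now replace (k + (c - k))%nat with c by lia. }
    destruct (Nat.eq_dec (c - k) 0) as [e|e].
    + rewrite e in H'; simpl in H'; apply Hsg, cong_close; auto; lra.
    + apply (HM (c - k)%nat); [lia|].
      apply (open_arc_cong _ _ s); auto; exists 0%Z; simpl; lra.
  - split; auto.
    apply (lift_cong_inv (Nat.iter c F)); [now apply lift_iter|].
    rewrite <- Nat.iter_add; now replace (c + (k - c))%nat with k by lia.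
Qed.

Lemma iter_preimage F k t s y :
  circle_lift F -> Nat.iter k F t < y < Nat.iter k F s ->
  exists x, t < x < s /\ Nat.iter k F x = y.
Proof.
  intros HF Hy; assert (HK := lift_iter F k HF).
  destruct (lift_surj _ HK y) as [x <-]; exists x.
  repeat split; now apply (lift_lt_inv (Nat.iter k F)).
Qed.

(* Infinite descent: a visit to [ga] at time k' forces an earlier one at time k' - P,
   made by a point closer to [t], because the iterate of [t] itself lies outside the
   arc and so the image of the interval between them covers [al]. *)
Lemma descent_left F al be ga M P t k :
  circle_lift F -> be < al + 1 -> al < ga < be ->
  (forall i, (1 <= i <= M)%nat -> ~ open_arc al be (Nat.iter i F ga)) ->
  (1 <= P <= M)%nat -> cong (Nat.iter P F ga) al ->
  al <= t < ga ->
  (forall i, (1 <= i < k)%nat -> ~ arc al be (Nat.iter i F t)) ->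
  forall k' s, (0 < k' < k)%nat -> t < s < ga -> ~ cong (Nat.iter k' F s) ga.
Proof.
  intros HF Hab Hg HM HP HPa Ht Hk k'.
  induction k' as [k' IH] using lt_wf_ind; intros s Hk' Hs [z Hz].
  assert (HK := lift_iter F k' HF).
  assert (h1 : Nat.iter k' F t < ga + IZR z)
    by (rewrite <- Hz; apply (lift_incr _ HK); lra).
  assert (h2 : Nat.iter k' F t < al + IZR z).
  { apply Rnot_le_lt; intros h; apply (Hk k'); [lia|].
    exists (- z)%Z; rewrite opp_IZR; lra. }
  destruct (iter_preimage F k' t s (al + IZR z) HF) as [s' [Hs' e]]; [lra|].
  destruct (return_index F al be ga M k' P s') as [l1 l2]; auto; try lia; try lra.
  { rewrite e; apply (cong_trans _ al); [apply cong_add|now apply cong_sym]. }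
  apply (IH (k' - P)%nat) with (s := s'); auto; try lia; lra.
Qed.

(** Mirror image of [descent_left]. The arc omits [be], so the iterate of [t] may fall exactly on
    [be]; this is why [s = t] has to be allowed. *)
Lemma descent_right F al be ga M Q t k :
  circle_lift F -> be < al + 1 -> al < ga < be ->
  (forall i, (1 <= i <= M)%nat -> ~ open_arc al be (Nat.iter i F ga)) ->
  (1 <= Q <= M)%nat -> cong (Nat.iter Q F ga) be ->
  ga <= t < be ->
  (forall i, (1 <= i < k)%nat -> ~ arc al be (Nat.iter i F t)) ->
  forall k' s, (0 < k' < k)%nat -> ga < s <= t -> ~ cong (Nat.iter k' F s) ga.
Proof.
  intros HF Hab Hg HM HP HPa Ht Hk k'.
  induction k' as [k' IH] using lt_wf_ind; intros s Hk' Hs [z Hz].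
  assert (HK := lift_iter F k' HF).
  assert (h1 : ga + IZR z <= Nat.iter k' F t)
    by (rewrite <- Hz; apply (lift_le _ _ _ HK); lra).
  assert (h2 : be + IZR z <= Nat.iter k' F t).
  { apply Rnot_lt_le; intros h; apply (Hk k'); [lia|].
    exists (- z)%Z; rewrite opp_IZR; lra. }
  assert (Hs' : exists s', s < s' <= t /\ Nat.iter k' F s' = be + IZR z).
  { destruct h2 as [h2|h2].
    - destruct (iter_preimage F k' s t (be + IZR z) HF) as [s' [Hs' e]]; [lra|].
      exists s'; split; auto; lra.
    - exists t; split; auto; split; [|lra].
      apply (lift_lt_inv _ _ _ HK); lra. }
  destruct Hs' as [s' [Hs' e]].
  destruct (return_index F al be ga M k' Q s') as [l1 l2]; auto; try lia; try lra.
  { rewrite e; apply (cong_trans _ be); [apply cong_add|now apply cong_sym]. }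
  apply (IH (k' - Q)%nat) with (s := s'); auto; try lia; lra.
Qed.

(** The interval from [t] to [ga] moves as a block whose front [ga] reaches [be] at time [Q]. An
    earlier entry of [t] would put [ga] in the open arc, or on [be] too soon, or stretch the block
    across [be], and [return_index] forbids a hit on [be] before [Q]. At time [Q] the block could
    only fail by stretching back across [al], which [descent_left] rules out. *)
Lemma left_return F al be ga M P Q t :
  circle_lift F -> aperiodic F -> be < al + 1 -> al < ga < be ->
  (forall i, (1 <= i <= M)%nat -> ~ open_arc al be (Nat.iter i F ga)) ->
  (1 <= P <= M)%nat -> cong (Nat.iter P F ga) al ->
  (1 <= Q <= M)%nat -> cong (Nat.iter Q F ga) be ->
  al <= t < ga ->
  (forall i, (1 <= i < Q)%nat -> ~ arc al be (Nat.iter i F t)) /\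
  arc al be (Nat.iter Q F t).
Proof.
  intros HF HA Hab Hg HM HP HPa HQ HQb Ht.
  assert (H1 : forall i, (1 <= i < Q)%nat -> ~ arc al be (Nat.iter i F t)).
  { intros i Hi [z Hz].
    assert (HK := lift_iter F i HF).
    assert (h : Nat.iter i F t < Nat.iter i F ga) by (apply (lift_incr _ HK); lra).
    destruct (Rtotal_order (Nat.iter i F ga + IZR z) be) as [l|[l|l]].
    - apply (HM i); [lia|]; exists z; lra.
    - assert (i = Q); [|lia]; apply (aperiodic_index F i Q ga); auto.
      apply (cong_trans _ be); [|now apply cong_sym].
      rewrite <- l; apply cong_sym, cong_add.
    - destruct (iter_preimage F i t ga (be - IZR z) HF) as [s [Hs e]]; [lra|].
      destruct (return_index F al be ga M i Q s) as [l1 l2]; auto; try lia; try lra.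
      rewrite e; apply (cong_trans _ be); [|now apply cong_sym].
      apply cong_sym; exists z; lra. }
  split; auto.
  assert (HK := lift_iter F Q HF).
  destruct HQb as [z Hz].
  assert (h : Nat.iter Q F t < Nat.iter Q F ga) by (apply (lift_incr _ HK); lra).
  destruct (Rle_lt_dec (al + IZR z) (Nat.iter Q F t)) as [l|l].
  { exists (- z)%Z; rewrite opp_IZR; lra. }
  exfalso.
  destruct (iter_preimage F Q t ga (al + IZR z) HF) as [s [Hs e]]; [lra|].
  destruct (return_index F al be ga M Q P s) as [l1 l2]; auto; try lia; try lra.
  { rewrite e; apply (cong_trans _ al); [apply cong_add|now apply cong_sym]. }
  apply (descent_left F al be ga M P t Q) with (k' := (Q - P)%nat) (s := s);
    auto; try lia; lra.
Qed.

(** Mirror image of [left_return]: now [ga] reaches [al] at time [P]. The case [t = ga] is included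
    because the half-open right piece starts there. *)
Lemma right_return F al be ga M P Q t :
  circle_lift F -> aperiodic F -> be < al + 1 -> al < ga < be ->
  (forall i, (1 <= i <= M)%nat -> ~ open_arc al be (Nat.iter i F ga)) ->
  (1 <= P <= M)%nat -> cong (Nat.iter P F ga) al ->
  (1 <= Q <= M)%nat -> cong (Nat.iter Q F ga) be ->
  ga <= t < be ->
  (forall i, (1 <= i < P)%nat -> ~ arc al be (Nat.iter i F t)) /\
  arc al be (Nat.iter P F t).
Proof.
  intros HF HA Hab Hg HM HP HPa HQ HQb Ht.
  assert (H1 : forall i, (1 <= i < P)%nat -> ~ arc al be (Nat.iter i F t)).
  { intros i Hi [z Hz].
    assert (HK := lift_iter F i HF).
    assert (h : Nat.iter i F ga <= Nat.iter i F t) by (apply (lift_le _ _ _ HK); lra).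
    destruct (Rtotal_order (Nat.iter i F ga + IZR z) al) as [l|[l|l]].
    - assert (Hs : exists s, ga < s <= t /\ Nat.iter i F s = al - IZR z).
      { destruct (Rle_lt_or_eq_dec al (Nat.iter i F t + IZR z)) as [h2|h2]; [lra| |].
        - destruct (iter_preimage F i ga t (al - IZR z) HF) as [s [Hs e]]; [lra|].
          exists s; split; auto; lra.
        - exists t; split; [|lra]; split; [|lra].
          apply (lift_lt_inv _ _ _ HK); lra. }
      destruct Hs as [s [Hs e]].
      destruct (return_index F al be ga M i P s) as [l1 l2]; auto; try lia; try lra.
      rewrite e; apply (cong_trans _ al); [|now apply cong_sym].
      apply cong_sym; exists z; lra.
    - assert (i = P); [|lia]; apply (aperiodic_index F i P ga); auto.
      apply (cong_trans _ al); [|now apply cong_sym].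
      rewrite <- l; apply cong_sym, cong_add.
    - apply (HM i); [lia|]; exists z; lra. }
  split; auto.
  assert (HK := lift_iter F P HF).
  destruct HPa as [z Hz].
  assert (h : Nat.iter P F ga <= Nat.iter P F t) by (apply (lift_le _ _ _ HK); lra).
  destruct (Rlt_le_dec (Nat.iter P F t) (be + IZR z)) as [l|l].
  { exists (- z)%Z; rewrite opp_IZR; lra. }
  exfalso.
  assert (Hs : exists s, ga < s <= t /\ Nat.iter P F s = be + IZR z).
  { destruct l as [l|l].
    - destruct (iter_preimage F P ga t (be + IZR z) HF) as [s [Hs e]]; [lra|].
      exists s; split; auto; lra.
    - exists t; split; [|lra]; split; [|lra].
      apply (lift_lt_inv _ _ _ HK); lra. }
  destruct Hs as [s [Hs e]].
  destruct (return_index F al be ga M P Q s) as [l1 l2]; auto; try lia; try lra.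
  { rewrite e; apply (cong_trans _ be); [apply cong_add|now apply cong_sym]. }
  apply (descent_right F al be ga M Q t P) with (k' := (P - Q)%nat) (s := s);
    auto; try lia; lra.
Qed.

(** By [return_index], such a meeting means that the orbit of [t] stood on [ga], hence in the arc,
    at the positive time [i - c < R]. It serves to keep iterates off the y-axis until they
    return. *)
Lemma avoids_before_return F al be ga M R t i c :
  circle_lift F -> be < al + 1 -> al < ga < be ->
  (forall i, (1 <= i <= M)%nat -> ~ open_arc al be (Nat.iter i F ga)) ->
  al < t < be -> t <> ga ->
  (forall i, (1 <= i < R)%nat -> ~ arc al be (Nat.iter i F t)) ->
  (c <= M)%nat -> (i < R)%nat ->
  ~ cong (Nat.iter i F t) (Nat.iter c F ga).
Proof.
  intros HF Hab Hg HM Ht Htg HR Hc Hi H.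
  destruct (return_index F al be ga M i c t) as [l1 l2]; auto.
  apply (HR (i - c)%nat); [lia|].
  apply (arc_cong _ _ ga); [now apply cong_sym|exists 0%Z; simpl; lra].
Qed.

(** The end [al] returns after [Q] steps, so the image of [ga] at time [P + Q] is in the arc;
    aperiodicity keeps it off [al], so it is interior, and interior visits happen only after [M]. *)
Lemma return_time_sum F al be ga M P Q :
  circle_lift F -> aperiodic F -> be < al + 1 -> al < ga < be ->
  (forall i, (1 <= i <= M)%nat -> ~ open_arc al be (Nat.iter i F ga)) ->
  (1 <= P <= M)%nat -> cong (Nat.iter P F ga) al ->
  (1 <= Q <= M)%nat -> cong (Nat.iter Q F ga) be ->
  (M < P + Q)%nat.
Proof.
  intros HF HA Hab Hg HM HP HPa HQ HQb.
  apply Nat.nle_gt; intros h.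
  destruct (left_return F al be ga M P Q al) as [_ H]; auto; [lra|].
  assert (C : cong (Nat.iter (P + Q) F ga) (Nat.iter Q F al)).
  { rewrite Nat.add_comm, Nat.iter_add; apply lift_cong; auto; now apply lift_iter. }
  apply (HM (P + Q)%nat); [lia|].
  apply (open_arc_cong _ _ (Nat.iter Q F al)); [now apply cong_sym|].
  destruct H as [z [[H1|H1] H2]]; [now exists z|exfalso].
  assert (P + Q = P)%nat; [|lia].
  apply (aperiodic_index F _ _ ga); auto.
  apply (cong_trans _ _ _ C), (cong_trans _ al); [|now apply cong_sym].
  exists (- z)%Z; rewrite opp_IZR; lra.
Qed.

(* The supremum of a bounded orbit would be a fixed point. *)
Lemma escape H x y :
  circle_lift H -> (forall t, H t <> t) -> x < H x -> x <= y ->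
  exists i, Nat.iter i H x <= y < Nat.iter (S i) H x.
Proof.
  intros HH Hfix Hx Hxy.
  destruct (classic (exists i, y < Nat.iter i H x)) as [Hi|Hi].
  - destruct (dec_inh_nat_subset_has_unique_least_element
      (fun i => y < Nat.iter i H x)) as [n [[Hn Hmin] _]]; auto.
    { intros n; apply classic. }
    destruct n as [|n]; [simpl in Hn; lra|exists n; split; auto].
    apply Rnot_lt_le; intros h; apply Hmin in h; lia.
  - exfalso.
    destruct (completeness (fun v => exists i, v = Nat.iter i H x)) as [c [c1 c2]].
    { exists y; intros v [i ->]; apply Rnot_lt_le; intros h; eauto. }
    { exists x; now exists 0%nat. }
    assert (h1 : forall i, Nat.iter i H x <= c) by (intros i; apply c1; now exists i).
    destruct (lift_surj H HH c) as [c' Hc'].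
    assert (h2 : c <= H c).
    { apply c2; intros v [i ->]; destruct i as [|i]; simpl.
      - apply Rle_trans with (H x); [lra|].
        apply lift_le; auto; apply (h1 0%nat).
      - apply lift_le; auto. }
    assert (h3 : c <= c').
    { apply c2; intros v [i ->]; apply Rnot_lt_le; intros h.
      apply (lift_incr H HH) in h; specialize (h1 (S i)); simpl in h1; lra. }
    apply (Hfix c); apply (lift_le H _ _ HH) in h3; lra.
Qed.

Lemma lift_sub F z : circle_lift F -> circle_lift (fun t => F t + IZR z).
Proof.
  intros HF; constructor.
  - intros s t h; apply (lift_incr F HF) in h; lra.
  - intros t z'; rewrite (lift_shift F HF); lra.
  - intros y; destruct (lift_surj F HF (y - IZR z)) as [x Hx]; exists x; lra.
Qed.

Lemma lift_reflect F : circle_lift F -> circle_lift (fun t => - F (- t)).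
Proof.
  intros HF; constructor.
  - intros s t h; assert (l : - t < - s) by lra; apply (lift_incr F HF) in l; lra.
  - intros t z; replace (- (t + IZR z)) with (- t + IZR (- z)) by (rewrite opp_IZR; lra).
    rewrite (lift_shift F HF), opp_IZR; lra.
  - intros y; destruct (lift_surj F HF (- y)) as [x Hx]; exists (- x).
    rewrite Ropp_involutive; lra.
Qed.

Lemma iter_reflect F k t :
  Nat.iter k (fun t => - F (- t)) t = - Nat.iter k F (- t).
Proof.
  induction k as [|k IH]; simpl; [lra|rewrite IH, Ropp_involutive; auto].
Qed.

Lemma iter_translate F d z k t :
  circle_lift F ->
  cong (Nat.iter k (fun t => Nat.iter d F t + IZR z) t) (Nat.iter (k * d) F t).
Proof.
  intros HF; induction k as [|k IH]; simpl; [apply cong_refl|].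
  apply (cong_trans _ _ _ (cong_add _ _)).
  rewrite Nat.iter_add; apply lift_cong; auto; now apply lift_iter.
Qed.

Lemma integer_above x y : exists z : Z, x <= y + IZR z.
Proof. exists (up (x - y)); destruct (archimed (x - y)); lra. Qed.

(* The iterates of the arc from [al] to [be] under a suitable integer translate of
   [F^|q-p|] are adjacent, and they fill a half line because that map has no fixed
   point. *)
Lemma backward_visit F al be p q x0 :
  circle_lift F -> aperiodic F -> al < be ->
  (1 <= p)%nat -> (1 <= q)%nat ->
  cong al (Nat.iter p F x0) -> cong be (Nat.iter q F x0) -> ~ cong al be ->
  exists n y, al < y < be /\ cong (Nat.iter n F y) x0.
Proof.
  intros HF HA Hab Hp Hq Hal Hbe Hne.
  (* The ends are images of [x0] at positive times, so an end leading back to [x0] would make [x0]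
     periodic. A visit in the closed arc is therefore enough. *)
  assert (W : forall n y, al <= y <= be -> cong (Nat.iter n F y) x0 ->
    exists n y, al < y < be /\ cong (Nat.iter n F y) x0).
  { assert (U : forall n c, (1 <= c)%nat -> cong (Nat.iter n F (Nat.iter c F x0)) x0 -> False).
    { intros n c Hc H; rewrite <- Nat.iter_add in H.
      apply (HA (n + c)%nat x0); auto; lia. }
    intros n y [[h1| <-] [h2| ->]] H; eauto; exfalso.
    - apply (U n q); auto; apply (cong_trans _ (Nat.iter n F be)); auto.
      apply lift_cong; [now apply lift_iter|now apply cong_sym].
    - apply (U n p); auto; apply (cong_trans _ (Nat.iter n F al)); auto.
      apply lift_cong; [now apply lift_iter|now apply cong_sym]. }
  assert (Hfix : forall d z, (0 < d)%nat -> forall t, Nat.iter d F t + IZR z <> t).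
  { intros d z Hd t e; apply (HA d t Hd); apply cong_sym; exists z; lra. }
  assert (B : forall c c' s s', (c < c')%nat -> cong s (Nat.iter c F x0) ->
    cong s' (Nat.iter c' F x0) -> exists z, Nat.iter (c' - c) F s + IZR z = s').
  { intros c c' s s' Hc H1 H2.
    assert (H3 : cong (Nat.iter c' F x0) (Nat.iter (c' - c) F s)).
    { replace (Nat.iter c' F x0) with (Nat.iter (c' - c) F (Nat.iter c F x0))
        by (rewrite <- Nat.iter_add; f_equal; lia).
      apply lift_cong; [now apply lift_iter|now apply cong_sym]. }
    destruct (cong_trans _ _ _ H2 H3) as [z Hz]; now exists z. }
  destruct (Nat.lt_trichotomy p q) as [h|[h|h]].
  - destruct (B p q al be h Hal Hbe) as [z Hz].
    set (H := fun t => Nat.iter (q - p) F t + IZR z).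
    assert (HH : circle_lift H) by now apply lift_sub, lift_iter.
    destruct (integer_above al x0) as [w Hw].
    destruct (escape H al (x0 + IZR w)) as [i [Hi1 Hi2]]; auto.
    { apply Hfix; lia. }
    { unfold H; lra. }
    assert (HI := lift_iter H i HH).
    destruct (lift_surj _ HI (x0 + IZR w)) as [y Hy].
    (* As [H] sends [al] to [be], the next iterate of [al] is the current iterate of [be]: the
       target lies in the image of the arc under [i] steps. *)
    rewrite Nat.iter_succ_r in Hi2; replace (H al) with be in Hi2 by (unfold H; lra).
    apply (W (i * (q - p))%nat y).
    + split.
      * apply Rnot_lt_le; intros l; apply (lift_incr _ HI) in l; lra.
      * left; apply (lift_lt_inv _ _ _ HI); lra.
    + apply (cong_trans _ (Nat.iter i H y)); [|rewrite Hy; apply cong_add].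
      now apply cong_sym, iter_translate.
  - exfalso; subst q; apply Hne, (cong_trans _ _ _ Hal); now apply cong_sym.
  - destruct (B q p be al h Hbe Hal) as [z Hz].
    set (H := fun t => Nat.iter (p - q) F t + IZR z).
    assert (HH : circle_lift H) by now apply lift_sub, lift_iter.
    (* Here [H] sends [be] to [al] and moves it to the left; conjugating by the reflection gives a
       map to which [escape] applies. *)
    set (K := fun t => - H (- t)).
    assert (HK : circle_lift K) by now apply lift_reflect.
    destruct (integer_above (- be) (- x0)) as [w Hw].
    destruct (escape K (- be) (- x0 + IZR w)) as [i [Hi1 Hi2]]; auto.
    { intros t e; apply (Hfix (p - q)%nat z ltac:(lia) (- t)).
      unfold K, H in e; lra. }
    { unfold K, H; rewrite Ropp_involutive; lra. }
    assert (HI := lift_iter K i HK).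
    destruct (lift_surj _ HI (- x0 + IZR w)) as [y Hy].
    rewrite Nat.iter_succ_r in Hi2.
    replace (K (- be)) with (- al) in Hi2 by (unfold K, H; rewrite Ropp_involutive; lra).
    apply (W (i * (p - q))%nat (- y)).
    + split.
      * left; enough (y < - al) by lra; apply (lift_lt_inv _ _ _ HI); lra.
      * enough (- be <= y) by lra.
        apply Rnot_lt_le; intros l; apply (lift_incr _ HI) in l; lra.
    + apply (cong_trans _ (Nat.iter i H (- y))).
      { now apply cong_sym, iter_translate. }
      unfold K in Hy; rewrite iter_reflect in Hy.
      apply cong_sym; exists w; lra.
Qed.

(** * Polar coordinates and linear algebra in the plane *)

Definition dir (t : R) : vec := (cos (2 * PI * t), sin (2 * PI * t)).

Lemma trig_shift t z :
  cos (2 * PI * (t + IZR z)) = cos (2 * PI * t) /\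
  sin (2 * PI * (t + IZR z)) = sin (2 * PI * t).
Proof.
  assert (P : forall t n, cos (2 * PI * (t + INR n)) = cos (2 * PI * t) /\
    sin (2 * PI * (t + INR n)) = sin (2 * PI * t)).
  { intros t' n.
    replace (2 * PI * (t' + INR n)) with (2 * PI * t' + 2 * INR n * PI) by ring.
    now rewrite cos_period, sin_period. }
  destruct (Z_le_gt_dec 0 z) as [h|h].
  - rewrite <- (Z2Nat.id z h), <- INR_IZR_INZ; apply P.
  - destruct (P (t + IZR z) (Z.to_nat (- z))) as [P1 P2].
    rewrite <- P1, <- P2, INR_IZR_INZ, Z2Nat.id by lia.
    rewrite opp_IZR.
    now replace (t + IZR z + - IZR z) with t by ring.
Qed.

Lemma dir_cong s t : cong s t -> dir s = dir t.
Proof.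
  intros [z ->]; unfold dir; destruct (trig_shift t z) as [-> ->]; reflexivity.
Qed.

Lemma cos_sin_unit t : cos (2 * PI * t) ^ 2 + sin (2 * PI * t) ^ 2 = 1.
Proof. generalize (sin2_cos2 (2 * PI * t)); unfold Rsqr; nra. Qed.

Lemma dir_vscale_inj r r' s t :
  0 < r -> 0 < r' -> vscale r (dir s) = vscale r' (dir t) -> r = r' /\ cong s t.
Proof.
  unfold vscale, dir; simpl; intros Hr Hr' H.
  injection H as H1 H2.
  assert (U1 := cos_sin_unit s); assert (U2 := cos_sin_unit t).
  set (c := cos (2 * PI * s)) in *; set (d := sin (2 * PI * s)) in *.
  set (c' := cos (2 * PI * t)) in *; set (d' := sin (2 * PI * t)) in *.
  assert (e : r = r').
  { assert (h : r ^ 2 = r' ^ 2).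
    { transitivity ((r * c) ^ 2 + (r * d) ^ 2).
      - replace ((r * c) ^ 2 + (r * d) ^ 2) with (r ^ 2 * (c ^ 2 + d ^ 2)) by ring.
        rewrite U1; ring.
      - rewrite H1, H2.
        replace ((r' * c') ^ 2 + (r' * d') ^ 2) with (r' ^ 2 * (c' ^ 2 + d' ^ 2)) by ring.
        rewrite U2; ring. }
    nra. }
  split; auto; subst r'.
  apply Rmult_eq_reg_l in H1; [|lra]; apply Rmult_eq_reg_l in H2; [|lra].
  assert (S : sin (2 * PI * (s - t)) = 0).
  { replace (2 * PI * (s - t)) with (2 * PI * s - 2 * PI * t) by ring.
    rewrite sin_minus; fold c d c' d'; rewrite H1, H2; ring. }
  assert (C : cos (2 * PI * (s - t)) = 1).
  { replace (2 * PI * (s - t)) with (2 * PI * s - 2 * PI * t) by ring.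
    rewrite cos_minus; fold c d c' d'; rewrite H1, H2; nra. }
  assert (HPI := PI_RGT_0).
  destruct (sin_eq_0_0 _ S) as [k Hk].
  assert (Hk' : s - t = IZR k / 2).
  { apply (Rmult_eq_reg_l (2 * PI)); [|lra]; rewrite Hk; field. }
  destruct (Z.Even_or_Odd k) as [[j ->]|[j ->]].
  - exists j; rewrite mult_IZR in Hk'; lra.
  - exfalso; rewrite Hk' in C.
    replace (2 * PI * (IZR (2 * j + 1) / 2)) with (2 * PI * (1 / 2 + IZR j)) in C
      by (rewrite plus_IZR, mult_IZR; field).
    destruct (trig_shift (1 / 2) j) as [e _]; rewrite e in C.
    replace (2 * PI * (1 / 2)) with PI in C by field.
    rewrite cos_PI in C; lra.
Qed.

Lemma vscale_1 p : vscale 1 p = p.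
Proof. destruct p; unfold vscale; simpl; f_equal; ring. Qed.

Lemma vscale_vscale r r' p : vscale r (vscale r' p) = vscale (r * r') p.
Proof. destruct p; unfold vscale; simpl; f_equal; ring. Qed.

Lemma dir_inj s t : dir s = dir t -> cong s t.
Proof.
  intros H; apply (dir_vscale_inj 1 1); try lra; now rewrite H.
Qed.

Lemma vnorm_pos p : p <> (0, 0) -> 0 < vnorm p.
Proof.
  destruct p as [x y]; intros H; unfold vnorm; simpl; apply sqrt_lt_R0.
  destruct (Req_dec x 0) as [->|h]; destruct (Req_dec y 0) as [->|h']; try nra.
  now elim H.
Qed.

Lemma polar p : p <> (0, 0) -> exists r t, 0 < r /\ p = vscale r (dir t).
Proof.
  intros Hp; assert (Hr := vnorm_pos p Hp).
  destruct p as [x y]; unfold vnorm in Hr; simpl in Hr.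
  set (r := sqrt (x * (x * 1) + y * (y * 1))) in *.
  assert (Hr2 : r * r = x * x + y * y).
  { unfold r; rewrite sqrt_sqrt; nra. }
  assert (Hx : -1 <= x / r <= 1).
  { split; apply (Rmult_le_reg_r r); auto; unfold Rdiv;
      rewrite Rmult_assoc, Rinv_l by lra; nra. }
  assert (Hs : sqrt (1 - (x / r)²) = Rabs (y / r)).
  { rewrite <- sqrt_Rsqr_abs; f_equal; unfold Rsqr.
    apply (Rmult_eq_reg_r (r * r)); [|nra].
    transitivity (r * r - x * x); [field; lra|].
    transitivity (y * y); [lra|field; lra]. }
  assert (HPI := PI_RGT_0).
  destruct (Rle_lt_dec 0 y) as [h|h].
  - exists r, (acos (x / r) / (2 * PI)); split; auto; unfold vscale, dir; simpl.
    replace (2 * PI * (acos (x / r) / (2 * PI))) with (acos (x / r)) by (field; lra).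
    rewrite cos_acos, sin_acos, Hs, Rabs_pos_eq by
      (auto; apply Rmult_le_pos; auto; left; now apply Rinv_0_lt_compat).
    f_equal; field; lra.
  - exists r, (- acos (x / r) / (2 * PI)); split; auto; unfold vscale, dir; simpl.
    replace (2 * PI * (- acos (x / r) / (2 * PI))) with (- acos (x / r)) by (field; lra).
    rewrite cos_neg, sin_neg, cos_acos, sin_acos, Hs, Rabs_left by
      (auto; unfold Rdiv; rewrite <- (Rmult_0_l (/ r));
       apply Rmult_lt_compat_r; auto; now apply Rinv_0_lt_compat).
    f_equal; field; lra.
Qed.

Lemma dir_nonzero r t : 0 < r -> vscale r (dir t) <> (0, 0).
Proof.
  unfold vscale, dir; simpl; intros Hr H; injection H as H1 H2.
  assert (U := cos_sin_unit t).
  apply Rmult_integral in H1; apply Rmult_integral in H2.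
  destruct H1 as [H1|H1]; [lra|]; destruct H2 as [H2|H2]; [lra|].
  rewrite H1, H2 in U; lra.
Qed.

Lemma T_vscale a b r p : 0 < r -> T a b (vscale r p) = vscale r (T a b p).
Proof.
  intros Hr; destruct p as [x y]; unfold vscale, T; simpl.
  destruct (Rle_dec 0 (r * x)), (Rle_dec 0 x); simpl; try (f_equal; ring);
  exfalso; nra.
Qed.

Lemma T_inj a b p p' : T a b p = T a b p' -> p = p'.
Proof.
  destruct p as [x y], p' as [x' y']; unfold T.
  destruct (Rle_dec 0 x), (Rle_dec 0 x'); intros H; injection H as H1 H2; subst;
  try contradiction; f_equal; lra.
Qed.

Lemma T_nonzero a b p : p <> (0, 0) -> T a b p <> (0, 0).
Proof.
  destruct p as [x y]; intros Hp H; apply Hp; unfold T in H.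
  destruct (Rle_dec 0 x); injection H as H1 H2; subst; f_equal; lra.
Qed.

Lemma Tinv_T a b p : T a b (Tinv a b p) = p.
Proof.
  destruct p as [x y]; unfold T, Tinv.
  destruct (Rle_dec 0 y); simpl; destruct (Rle_dec 0 y); try contradiction;
  f_equal; ring.
Qed.

Lemma Tn_succ_r a b n p : Tn a b (S n) p = Tn a b n (T a b p).
Proof. induction n as [|n IH]; simpl in *; auto; now rewrite IH. Qed.

Lemma Tn_Tinvn a b n p : Tn a b n (Tinvn a b n p) = p.
Proof.
  induction n as [|n IH]; auto; rewrite Tn_succ_r; simpl; now rewrite Tinv_T.
Qed.

Lemma Tn_add a b m n p : Tn a b (m + n) p = Tn a b m (Tn a b n p).
Proof. induction m as [|m IH]; simpl; congruence. Qed.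

Lemma Tn_zero a b n : Tn a b n (0, 0) = (0, 0).
Proof.
  induction n as [|n IH]; simpl; auto; rewrite IH; unfold T.
  destruct (Rle_dec 0 0); f_equal; ring.
Qed.

(** * Matrices, oriented area, and the half planes on which T is linear *)

Definition mat_det (M : mat) : R := m11 M * m22 M - m12 M * m21 M.

Definition mat_id : mat := Mat 1 0 0 1.

Lemma mat_eq M N :
  m11 M = m11 N -> m12 M = m12 N -> m21 M = m21 N -> m22 M = m22 N -> M = N.
Proof. destruct M, N; simpl; now intros -> -> -> ->. Qed.

Lemma mat_mul_assoc M N P : mat_mul (mat_mul M N) P = mat_mul M (mat_mul N P).
Proof. apply mat_eq; simpl; ring. Qed.

Lemma mat_mul_id_l M : mat_mul mat_id M = M.
Proof. apply mat_eq; simpl; ring. Qed.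

Lemma mat_mul_id_r M : mat_mul M mat_id = M.
Proof. apply mat_eq; simpl; ring. Qed.

Lemma mat_mul_apply M N p : mat_apply (mat_mul M N) p = mat_apply M (mat_apply N p).
Proof. destruct p; unfold mat_apply; simpl; f_equal; ring. Qed.

Lemma mat_det_mul M N : mat_det (mat_mul M N) = mat_det M * mat_det N.
Proof. unfold mat_det; simpl; ring. Qed.

Definition vdet (p q : vec) : R := fst p * snd q - snd p * fst q.

Lemma vdet_mat_apply M p q :
  vdet (mat_apply M p) (mat_apply M q) = mat_det M * vdet p q.
Proof. unfold vdet, mat_apply, mat_det; simpl; ring. Qed.

Lemma vdet_vscale r s p q : vdet (vscale r p) (vscale s q) = r * s * vdet p q.
Proof. unfold vdet, vscale; simpl; ring. Qed.

Lemma vdet_dir s t : vdet (dir s) (dir t) = sin (2 * PI * (t - s)).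
Proof.
  unfold vdet, dir; simpl.
  replace (2 * PI * (t - s)) with (2 * PI * t - 2 * PI * s) by ring.
  rewrite sin_minus; ring.
Qed.

Lemma mat_eq_on_basis M N p q :
  vdet p q <> 0 -> mat_apply M p = mat_apply N p -> mat_apply M q = mat_apply N q ->
  M = N.
Proof.
  destruct p as [p1 p2], q as [q1 q2]; unfold vdet, mat_apply; simpl.
  intros Hd H H'; injection H as H1 H2; injection H' as H3 H4.
  apply mat_eq; apply (Rmult_eq_reg_r (p1 * q2 - p2 * q1)); auto.
  - transitivity ((m11 M * p1 + m12 M * p2) * q2 - (m11 M * q1 + m12 M * q2) * p2);
      [ring|rewrite H1, H3; ring].
  - transitivity ((m11 M * q1 + m12 M * q2) * p1 - (m11 M * p1 + m12 M * p2) * q1);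
      [ring|rewrite H1, H3; ring].
  - transitivity ((m21 M * p1 + m22 M * p2) * q2 - (m21 M * q1 + m22 M * q2) * p2);
      [ring|rewrite H2, H4; ring].
  - transitivity ((m21 M * q1 + m22 M * q2) * p1 - (m21 M * p1 + m22 M * p2) * q1);
      [ring|rewrite H2, H4; ring].
Qed.

(* Angles are measured in turns: the half plane x <= 0 is k <= 2t - 1/2 <= k + 1 with k
   even, and x >= 0 is the same with k odd. *)
Definition cell_mat (a b : R) (k : Z) : mat := Mat (if Z.even k then b else a) (-1) 1 0.

Definition in_cell (k : Z) (t : R) : Prop := IZR k <= 2 * t - / 2 <= IZR k + 1.

Lemma cos_in_cell k t :
  in_cell k t -> if Z.even k then cos (2 * PI * t) <= 0 else 0 <= cos (2 * PI * t).
Proof.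
  unfold in_cell; intros Hk; assert (HPI := PI_RGT_0).
  rewrite <- Z.negb_odd; destruct (Z.odd k) eqn:E; simpl.
  - apply Z.odd_spec in E; destruct E as [j ->].
    rewrite plus_IZR, mult_IZR in Hk.
    destruct (trig_shift t (- (j + 1))) as [<- _].
    rewrite opp_IZR, plus_IZR; apply cos_ge_0; nra.
  - rewrite <- Z.negb_even in E; apply Bool.negb_false_iff, Z.even_spec in E.
    destruct E as [j ->]; rewrite mult_IZR in Hk.
    destruct (trig_shift t (- j)) as [<- _].
    rewrite opp_IZR; apply cos_le_0; nra.
Qed.

(** On the y-axis the first coordinate vanishes, so the coefficient [a] or [b] is irrelevant and
    both adjacent matrices give T. Hence cells can be closed at both ends. *)
Lemma T_on_cell a b k r t :
  0 < r -> in_cell k t ->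
  T a b (vscale r (dir t)) = mat_apply (cell_mat a b k) (vscale r (dir t)).
Proof.
  intros Hr Hk; apply cos_in_cell in Hk.
  unfold T, mat_apply, cell_mat, dir, vscale; simpl.
  destruct (Z.even k); destruct (Rle_dec 0 (r * cos (2 * PI * t))) as [h|h]; simpl;
    try (f_equal; ring).
  - assert (cos (2 * PI * t) = 0) as -> by nra; f_equal; ring.
  - exfalso; nra.
Qed.

Lemma cell_mat_det a b k : mat_det (cell_mat a b k) = 1.
Proof. unfold mat_det; simpl; ring. Qed.

Lemma exists_cell t : exists k, IZR k <= 2 * t - / 2 < IZR k + 1.
Proof.
  exists (Int_part (2 * t - / 2)); destruct (base_Int_part (2 * t - / 2)); lra.
Qed.

(** * The lift of the direction map *)

Lemma T_ray a b F r t :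
  is_lift a b F -> 0 < r ->
  exists r', 0 < r' /\ T a b (vscale r (dir t)) = vscale r' (dir (F t)).
Proof.
  intros [_ HF] Hr; specialize (HF t); fold (dir t) in HF; fold (dir (F t)) in HF.
  assert (Hn : 0 < vnorm (T a b (dir t))).
  { apply vnorm_pos, T_nonzero; rewrite <- (vscale_1 (dir t)); apply dir_nonzero; lra. }
  exists (r * vnorm (T a b (dir t))); split; [nra|].
  rewrite T_vscale by auto; rewrite HF; unfold Sab; rewrite vscale_vscale; f_equal.
  field; lra.
Qed.

Lemma Tn_ray a b F r t n :
  is_lift a b F -> 0 < r ->
  exists r', 0 < r' /\ Tn a b n (vscale r (dir t)) = vscale r' (dir (Nat.iter n F t)).
Proof.
  intros HF Hr; induction n as [|n [r' [Hr' IH]]]; [now exists r|].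
  simpl; rewrite IH; now apply T_ray.
Qed.

Lemma lift_sin_pos a b F k s t :
  is_lift a b F -> in_cell k s -> in_cell k t -> s < t < s + / 2 ->
  0 < sin (2 * PI * (F t - F s)).
Proof.
  intros HF Hs Ht Hst; assert (HPI := PI_RGT_0).
  destruct (T_ray a b F 1 s HF) as [r [Hr e]]; [lra|].
  destruct (T_ray a b F 1 t HF) as [r' [Hr' e']]; [lra|].
  assert (h : 0 < sin (2 * PI * (t - s))) by (apply sin_gt_0; nra).
  rewrite <- vdet_dir in *.
  rewrite (T_on_cell a b k) in e, e' by (auto; lra).
  assert (D : r * r' * vdet (dir (F s)) (dir (F t)) = vdet (dir s) (dir t)).
  { rewrite <- vdet_vscale, <- e, <- e', vdet_mat_apply, cell_mat_det, !vscale_1; ring. }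
  assert (0 < r * r') by nra; nra.
Qed.

(** Positivity of the sine locates [F t - F s] in (0, 1/2) only modulo 1. Continuity removes the
    ambiguity: starting from 0, the difference would have to pass through -1/4 or reach 1/2, where
    the sine is not positive. *)
Lemma lift_step a b F k s t :
  is_lift a b F -> in_cell k s -> in_cell k t -> s < t < s + / 2 ->
  0 < F t - F s < / 2.
Proof.
  intros HF Hs Ht Hst; assert (HPI := PI_RGT_0).
  assert (HP : forall z, s < z <= t -> 0 < sin (2 * PI * (F z - F s))).
  { intros z Hz; apply (lift_sin_pos a b F k); auto; [|lra].
    unfold in_cell in *; lra. }
  assert (CF := proj1 HF).
  assert (ht := HP t ltac:(lra)).
  split; apply Rnot_le_lt; intros h.
  - assert (h2 : F t - F s <= - / 2).
    { apply Rnot_lt_le; intros h2; destruct h as [h|h].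
      - assert (sin (2 * PI * (F t - F s)) < 0); [|lra].
        apply sin_lt_0_var; nra.
      - rewrite h, Rmult_0_r, sin_0 in ht; lra. }
    destruct (IVT (fun z => F s - F z - / 4) s t) as [z [Hz e]]; try lra.
    { apply continuity_minus; [|apply continuity_const; now intros ? ?].
      apply continuity_minus; [apply continuity_const; now intros ? ?|auto]. }
    assert (s <> z) by (intros <-; lra).
    specialize (HP z ltac:(lra)).
    replace (2 * PI * (F z - F s)) with (- (PI / 2)) in HP
      by (replace (F z - F s) with (- / 4) by lra; field).
    rewrite sin_neg, sin_PI2 in HP; lra.
  - destruct h as [h|h].
    + destruct (IVT (fun z => F z - F s - / 2) s t) as [z [Hz e]]; try lra.
      { apply continuity_minus; [|apply continuity_const; now intros ? ?].
        apply continuity_minus; [auto|apply continuity_const; now intros ? ?]. }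
      assert (s <> z) by (intros <-; lra).
      specialize (HP z ltac:(lra)).
      replace (2 * PI * (F z - F s)) with PI in HP
        by (replace (F z - F s) with (/ 2) by lra; field).
      rewrite sin_PI in HP; lra.
    + rewrite <- h in ht; replace (2 * PI * / 2) with PI in ht by field.
      rewrite sin_PI in ht; lra.
Qed.

(** A cell is exactly half a turn long, while [lift_step] needs strictly less; two steps through the
    midpoint cover this case. *)
Lemma lift_cell a b F k s t :
  is_lift a b F -> in_cell k s -> in_cell k t -> s < t -> 0 < F t - F s < 1.
Proof.
  intros HF Hs Ht h.
  assert (Hm : in_cell k ((s + t) / 2)) by (unfold in_cell in *; lra).
  assert (S1 := lift_step a b F k s ((s + t) / 2) HF Hs Hm).
  assert (S2 := lift_step a b F k ((s + t) / 2) t HF Hm Ht).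
  unfold in_cell in *; lra.
Qed.

Lemma is_lift_incr a b F s t : is_lift a b F -> s < t -> F s < F t.
Proof.
  intros HF h.
  assert (W : forall n k s t, in_cell k s -> in_cell (k + Z.of_nat n) t ->
    s < t -> F s < F t).
  { clear s t h; intros n; induction n as [|n IH]; intros k s t Hs Ht h.
    - rewrite Z.add_0_r in Ht; assert (L := lift_cell a b F k s t HF Hs Ht h); lra.
    - set (k' := (k + Z.of_nat (S n))%Z) in *.
      (* The y-axis angle shared by the cells [k' - 1] and [k']. *)
      set (c := (IZR k' + / 2) / 2).
      assert (e : IZR (k + Z.of_nat n) = IZR k' - 1).
      { unfold k'; rewrite <- minus_IZR; f_equal; lia. }
      assert (C1 : in_cell k' c) by (unfold in_cell, c; lra).
      assert (C2 : in_cell (k + Z.of_nat n) c) by (unfold in_cell, c; lra).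
      destruct (Rlt_le_dec s c) as [l|l].
      + assert (L := IH k s c Hs C2 l).
        destruct (Rle_lt_or_eq_dec c t) as [l'|l'].
        * unfold in_cell, c in *; lra.
        * assert (L' := lift_cell a b F k' c t HF C1 Ht l'); lra.
        * now rewrite <- l'.
      + assert (L := lift_cell a b F k' s t HF).
        assert (IZR k <= IZR k' - 1).
        { rewrite <- minus_IZR; apply IZR_le; unfold k'; lia. }
        enough (0 < F t - F s < 1) by lra; apply L; auto.
        unfold in_cell, c in *; lra. }
  destruct (exists_cell s) as [k Hk]; destruct (exists_cell t) as [k' Hk'].
  assert (k <= k')%Z.
  { assert (H : IZR k < IZR (k' + 1)) by (rewrite plus_IZR; lra).
    apply lt_IZR in H; lia. }
  apply (W (Z.to_nat (k' - k)) k s t); auto; unfold in_cell; [lra|].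
  replace (k + Z.of_nat (Z.to_nat (k' - k)))%Z with k' by lia; lra.
Qed.

Lemma is_lift_one a b F t : is_lift a b F -> F (t + 1) = F t + 1.
Proof.
  intros HF.
  assert (D : forall t, exists d, F (t + 1) = F t + IZR d /\ (1 <= d)%Z).
  { intros s; destruct (dir_inj (F (s + 1)) (F s)) as [d Hd].
    { unfold dir; rewrite !(proj2 HF).
      fold (dir (s + 1)); fold (dir s); f_equal; apply dir_cong; now exists 1%Z. }
    exists d; split; auto.
    assert (L := is_lift_incr a b F s (s + 1) HF ltac:(lra)).
    assert (H : 0 < IZR d) by lra; apply lt_IZR in H; lia. }
  assert (W : forall t, F (t + 1) - F t < 2 -> F (t + 1) = F t + 1).
  { intros s H; destruct (D s) as [d [Hd h]]; rewrite Hd in H.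
    assert (H' : IZR d < 2) by lra; apply lt_IZR in H'.
    rewrite Hd; now replace d with 1%Z by lia. }
  assert (C : forall k, F ((IZR k + / 2) / 2 + 1) = F ((IZR k + / 2) / 2) + 1).
  { intros k; apply W; set (c := (IZR k + / 2) / 2).
    assert (L1 := lift_cell a b F k c (c + / 2) HF).
    assert (L2 := lift_cell a b F (k + 1) (c + / 2) (c + 1) HF).
    unfold in_cell in L1, L2; rewrite plus_IZR in L2; unfold c in *; lra. }
  apply W; destruct (exists_cell t) as [k Hk].
  assert (C1 := C k); assert (C2 := C (k + 2)%Z); rewrite plus_IZR in C2.
  set (c := (IZR k + / 2) / 2) in *.
  replace ((IZR k + 2 + / 2) / 2) with (c + 1) in C2 by (unfold c; field).
  assert (L1 := is_lift_incr a b F (t + 1) (c + 1 + 1) HF).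
  destruct (Rle_lt_or_eq_dec c t) as [l|l]; [unfold c; lra| |].
  - apply (is_lift_incr a b F _ _ HF) in l; unfold c in *; lra.
  - rewrite <- l; lra.
Qed.

Lemma is_lift_circle_lift a b F : is_lift a b F -> circle_lift F.
Proof.
  intros HF.
  assert (P : forall n t, F (t + INR n) = F t + INR n).
  { intros n; induction n as [|n IH]; intros t; [simpl; now rewrite !Rplus_0_r|].
    rewrite S_INR, <- Rplus_assoc, (is_lift_one a b F) by auto; rewrite IH; ring. }
  assert (Q : forall t z, F (t + IZR z) = F t + IZR z).
  { intros t z; destruct (Z_le_gt_dec 0 z) as [h|h].
    - rewrite <- (Z2Nat.id z h), <- INR_IZR_INZ; apply P.
    - assert (L := P (Z.to_nat (- z)) (t + IZR z)).
      rewrite INR_IZR_INZ, Z2Nat.id, opp_IZR in L by lia.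
      replace (t + IZR z + - IZR z) with t in L by ring; lra. }
  constructor; auto.
  - intros s t; now apply (is_lift_incr a b).
  - intros y.
    assert (E1 := Q 0 (up (y - F 0))); assert (E2 := Q 0 (Z.opp (up (F 0 - y)))).
    rewrite Rplus_0_l in E1, E2.
    destruct (archimed (y - F 0)); destruct (archimed (F 0 - y)).
    rewrite opp_IZR in E2.
    destruct (IVT (fun z => F z - y) (- IZR (up (F 0 - y))) (IZR (up (y - F 0))))
      as [x [_ Hx]]; try lra.
    { apply continuity_minus; [apply HF|apply continuity_const; now intros ? ?]. }
    exists x; lra.
Qed.

(** * From an irrational rotation number to aperiodicity *)

Lemma iter_periodic F q t z k :
  circle_lift F -> Nat.iter q F t = t + IZR z ->
  Nat.iter (k * q) F t = t + INR k * IZR z.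
Proof.
  intros HF H; induction k as [|k IH]; [simpl; ring|].
  replace (S k * q)%nat with (k * q + q)%nat by lia.
  rewrite Nat.iter_add, H, (lift_shift _ (lift_iter F _ HF)), IH, S_INR; ring.
Qed.

(** Each of the two points lies below an integer translate of the other, and iteration preserves
    this. It transfers the limit along the orbit of 0 to the orbit of a periodic point. *)
Lemma iter_bounded_gap F s t :
  circle_lift F -> exists C, forall n, Rabs (Nat.iter n F s - Nat.iter n F t) <= C.
Proof.
  intros HF.
  destruct (integer_above s t) as [z1 H1]; destruct (integer_above t s) as [z2 H2].
  exists (Rabs (IZR z1) + Rabs (IZR z2)); intros n.
  assert (HK := lift_iter F n HF).
  apply (lift_le _ _ _ HK) in H1; apply (lift_le _ _ _ HK) in H2.
  rewrite (lift_shift _ HK) in H1, H2.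
  unfold Rabs; repeat destruct Rcase_abs; lra.
Qed.

Lemma irrational_aperiodic a b L :
  rotation_number a b L -> irrational L ->
  exists F, is_lift a b F /\ circle_lift F /\ aperiodic F.
Proof.
  intros [F [HF HL]] Hirr; exists F.
  assert (HC := is_lift_circle_lift a b F HF); repeat split; auto; try apply HF;
    try apply HC.
  intros q t Hq [z Hz].
  apply (Hirr z q Hq); apply NNPP; intros Hne.
  assert (Hq' : 1 <= INR q) by (apply (le_INR 1); lia).
  destruct (iter_bounded_gap F 0 t HC) as [C HC'].
  set (d := Rabs (L * INR q - IZR z)).
  assert (Hd : 0 < d) by (apply Rabs_pos_lt; lra).
  (* At time [k * q] this tolerance amounts to [k * d / 2], half of the discrepancy [k * d] between
     [L] and a periodic orbit. The rest must be absorbed by the constant [B], which fails once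
     [k * d > 2 * B]. *)
  destruct (HL (d / (2 * INR q))) as [N HN].
  { apply Rdiv_lt_0_compat; lra. }
  set (B := C + Rabs t).
  destruct (INR_unbounded (2 * B / d)) as [K HK].
  set (k := S (N + K)).
  assert (Hk : INR K < INR k) by (apply lt_INR; unfold k; lia).
  assert (Hk0 : 0 < INR k) by (apply lt_0_INR; unfold k; lia).
  assert (HN' := HN (k * q)%nat ltac:(unfold k; nia)).
  specialize (HC' (k * q)%nat); rewrite (iter_periodic F q t z k HC Hz) in HC'.
  set (x := Nat.iter (k * q) F 0) in *.
  unfold Rdist in HN'; rewrite mult_INR in HN'.
  assert (G : Rabs (x - INR k * (L * INR q)) < INR k * (d / 2)).
  { replace (x - INR k * (L * INR q)) with
      ((x / (INR k * INR q) - L) * (INR k * INR q)) by (field; lra).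
    rewrite Rabs_mult, (Rabs_pos_eq (INR k * INR q)) by nra.
    apply Rlt_le_trans with (d / (2 * INR q) * (INR k * INR q)).
    - apply Rmult_lt_compat_r; [nra|auto].
    - right; field; lra. }
  assert (G2 : INR k * d <= B + INR k * (d / 2)).
  { unfold d at 1; rewrite <- (Rabs_pos_eq (INR k)) at 1 by lra.
    rewrite <- Rabs_mult.
    replace (INR k * (L * INR q - IZR z)) with
      ((x - (t + INR k * IZR z)) + t + - (x - INR k * (L * INR q))) by ring.
    eapply Rle_trans; [apply Rabs_triang|]; rewrite Rabs_Ropp.
    apply Rplus_le_compat; [|lra].
    eapply Rle_trans; [apply Rabs_triang|]; unfold B; lra. }
  assert (G3 : 2 * B / d * d < INR k * d) by (apply Rmult_lt_compat_r; lra).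
  replace (2 * B / d * d) with (2 * B) in G3 by (field; lra).
  lra.
Qed.

(** * Products of derivatives along orbits *)

(* [ccw_cell t] and [cw_cell t] are the cells just counterclockwise and just clockwise
   of [t]; they differ exactly when the ray of [t] is on the y-axis. *)
Definition ccw_cell (t : R) : Z := Int_part (2 * t - / 2).

Definition cw_cell (t : R) : Z := (- Int_part (/ 2 - 2 * t) - 1)%Z.

Lemma cell_unique k k' x :
  IZR k <= x < IZR k + 1 -> IZR k' <= x < IZR k' + 1 -> k = k'.
Proof.
  intros H H'; assert (h : IZR k < IZR k' + 1) by lra.
  assert (h' : IZR k' < IZR k + 1) by lra.
  rewrite <- plus_IZR in h, h'; apply lt_IZR in h; apply lt_IZR in h'; lia.
Qed.

Lemma ccw_cell_bounds t : IZR (ccw_cell t) <= 2 * t - / 2 < IZR (ccw_cell t) + 1.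
Proof. unfold ccw_cell; destruct (base_Int_part (2 * t - / 2)); lra. Qed.

Lemma ccw_cell_unique k t : IZR k <= 2 * t - / 2 < IZR k + 1 -> ccw_cell t = k.
Proof. intros H; exact (cell_unique _ _ _ (ccw_cell_bounds t) H). Qed.

Lemma cw_cell_bounds t : IZR (cw_cell t) < 2 * t - / 2 <= IZR (cw_cell t) + 1.
Proof.
  unfold cw_cell; rewrite minus_IZR, opp_IZR.
  destruct (base_Int_part (/ 2 - 2 * t)); lra.
Qed.

Lemma cw_cell_unique k t : IZR k < 2 * t - / 2 <= IZR k + 1 -> cw_cell t = k.
Proof.
  intros H; assert (H' := cw_cell_bounds t).
  assert (- cw_cell t = - k)%Z; [|lia].
  apply (cell_unique _ _ (/ 2 - 2 * t + 1)); rewrite opp_IZR; lra.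
Qed.

Lemma ccw_cell_in t : in_cell (ccw_cell t) t.
Proof. assert (H := ccw_cell_bounds t); unfold in_cell; lra. Qed.

Lemma cw_cell_in t : in_cell (cw_cell t) t.
Proof. assert (H := cw_cell_bounds t); unfold in_cell; lra. Qed.

(** A turn contains two cells, so the shift by [2 * z] preserves parity and with it the matrix. *)
Definition cell_selector (kap : R -> Z) : Prop :=
  (forall t, in_cell (kap t) t) /\ (forall t z, kap (t + IZR z) = (kap t + 2 * z)%Z).

Lemma ccw_cell_selector : cell_selector ccw_cell.
Proof.
  split; [apply ccw_cell_in|intros t z].
  apply ccw_cell_unique; assert (H := ccw_cell_bounds t).
  rewrite plus_IZR, mult_IZR; lra.
Qed.

Lemma cw_cell_selector : cell_selector cw_cell.
Proof.
  split; [apply cw_cell_in|intros t z].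
  apply cw_cell_unique; assert (H := cw_cell_bounds t).
  rewrite plus_IZR, mult_IZR; lra.
Qed.

(** The derivative of T^N along the ray of [t]; [kap] decides which one-sided derivative is taken
    when the orbit is on the y-axis. *)
Fixpoint transfer (a b : R) (kap : R -> Z) (F : R -> R) (N : nat) (t : R) : mat :=
  match N with
  | O => mat_id
  | S n => mat_mul (cell_mat a b (kap (Nat.iter n F t))) (transfer a b kap F n t)
  end.

Lemma transfer_apply a b kap F N r t :
  is_lift a b F -> cell_selector kap -> 0 < r ->
  Tn a b N (vscale r (dir t)) = mat_apply (transfer a b kap F N t) (vscale r (dir t)).
Proof.
  intros HF [Hk _] Hr; induction N as [|N IH].
  - simpl; destruct (vscale r (dir t)); unfold mat_apply; simpl; f_equal; ring.
  - simpl; rewrite mat_mul_apply, <- IH.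
    destruct (Tn_ray a b F r t N HF Hr) as [r' [Hr' ->]].
    now apply T_on_cell.
Qed.

Lemma transfer_det a b kap F N t : mat_det (transfer a b kap F N t) = 1.
Proof.
  induction N as [|N IH]; [unfold mat_det; simpl; ring|].
  simpl transfer; rewrite mat_det_mul, IH, cell_mat_det; ring.
Qed.

Lemma transfer_add a b kap F m n t :
  transfer a b kap F (m + n) t =
  mat_mul (transfer a b kap F m (Nat.iter n F t)) (transfer a b kap F n t).
Proof.
  induction m as [|m IH].
  - simpl; now rewrite mat_mul_id_l.
  - simpl; rewrite IH, mat_mul_assoc; now rewrite <- Nat.iter_add.
Qed.

Lemma transfer_cong a b kap F N s t :
  circle_lift F -> cell_selector kap -> cong s t ->
  transfer a b kap F N s = transfer a b kap F N t.
Proof.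
  intros HF [_ Hk] [z ->]; induction N as [|N IH]; auto.
  simpl; rewrite IH; f_equal.
  rewrite (lift_shift _ (lift_iter F N HF)), Hk; unfold cell_mat.
  now rewrite Z.even_add_mul_2.
Qed.

Lemma transfer_ext a b kap kap' F N s t :
  (forall i, (i < N)%nat -> kap (Nat.iter i F s) = kap' (Nat.iter i F t)) ->
  transfer a b kap F N s = transfer a b kap' F N t.
Proof.
  intros H; induction N as [|N IH]; auto.
  simpl; rewrite H, IH; auto.
Qed.

Definition on_axis (t : R) : Prop := cong t (/ 4) \/ cong t (3 / 4).

Lemma on_axis_intro k t : 2 * t - / 2 = IZR k -> on_axis t.
Proof.
  intros H; destruct (Z.Even_or_Odd k) as [[j ->]|[j ->]].
  - left; exists j; rewrite mult_IZR in H; lra.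
  - right; exists j; rewrite plus_IZR, mult_IZR in H; lra.
Qed.

Lemma off_axis_cells s t x :
  s < t -> s <= x < t -> (forall y, s < y < t -> ~ on_axis y) ->
  ccw_cell s = cw_cell t /\ ccw_cell x = ccw_cell s.
Proof.
  intros Hst Hx H; assert (B := ccw_cell_bounds s).
  set (k := ccw_cell s) in *.
  assert (h : 2 * t - / 2 <= IZR k + 1).
  { apply Rnot_lt_le; intros h.
    apply (H ((IZR k + 1 + / 2) / 2)); [lra|].
    apply (on_axis_intro (k + 1)); rewrite plus_IZR; field. }
  split; [symmetry; apply cw_cell_unique; lra|apply ccw_cell_unique; lra].
Qed.

(** Each iterate of the open interval stays within one cell, so the derivative is constant there and
    agrees with the one-sided derivatives taken from inside at both ends. *)
Lemma off_axis_transfer a b F N s t x :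
  circle_lift F -> s < t -> s <= x < t ->
  (forall y i, s < y < t -> (i < N)%nat -> ~ on_axis (Nat.iter i F y)) ->
  transfer a b ccw_cell F N s = transfer a b cw_cell F N t /\
  transfer a b ccw_cell F N x = transfer a b ccw_cell F N s.
Proof.
  intros HF Hst Hx H.
  assert (W : forall i, (i < N)%nat ->
    ccw_cell (Nat.iter i F s) = cw_cell (Nat.iter i F t) /\
    ccw_cell (Nat.iter i F x) = ccw_cell (Nat.iter i F s)).
  { intros i Hi; assert (HK := lift_iter F i HF).
    apply off_axis_cells.
    - now apply (lift_incr _ HK).
    - split; [now apply lift_le|now apply (lift_incr _ HK)].
    - intros y Hy; destruct (iter_preimage F i s t y HF Hy) as [y' [Hy' <-]].
      now apply H. }
  split; apply transfer_ext; intros i Hi; now apply W.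
Qed.

(* The matrix of w |-> w + c det(u,w) u. *)
Definition shear (c : R) (u : vec) : mat :=
  Mat (1 - c * (fst u * snd u)) (c * (fst u * fst u))
      (- c * (snd u * snd u)) (1 + c * (fst u * snd u)).

(** A map of determinant 1 preserves the area form in the shear, so conjugation changes only the
    vector and keeps the coefficient. *)
Lemma shear_conj M c u :
  mat_det M = 1 -> mat_mul (shear c (mat_apply M u)) M = mat_mul M (shear c u).
Proof.
  destruct M as [p q r s], u as [x y]; unfold mat_det; simpl; intros H.
  (* Each entry of the identity holds up to a multiple of the determinant minus 1; [K] is that
     multiple. *)
  assert (E : forall A B K : R, A - B = K * (p * s - q * r - 1) -> A = B).
  { intros A B K e; rewrite H in e; lra. }
  apply mat_eq; simpl.
  - apply (E _ _ (- c * y * (p * x + q * y))); ring.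
  - apply (E _ _ (c * x * (p * x + q * y))); ring.
  - apply (E _ _ (- c * y * (r * x + s * y))); ring.
  - apply (E _ _ (c * x * (r * x + s * y))); ring.
Qed.

Lemma shear_add c d u : mat_mul (shear c u) (shear d u) = shear (c + d) u.
Proof. apply mat_eq; simpl; ring. Qed.

Lemma shear_0 u : shear 0 u = mat_id.
Proof. apply mat_eq; simpl; ring. Qed.

Lemma dir_up : vscale 1 (dir (/ 4)) = e_up.
Proof.
  unfold vscale, dir, e_up; simpl.
  replace (2 * PI * / 4) with (PI / 2) by field.
  rewrite cos_PI2, sin_PI2; f_equal; ring.
Qed.

Lemma dir_down : vscale 1 (dir (3 / 4)) = e_down.
Proof.
  unfold vscale, dir, e_down; simpl.
  replace (2 * PI * (3 / 4)) with (3 * (PI / 2)) by field.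
  rewrite cos_3PI2, sin_3PI2; f_equal; ring.
Qed.

Lemma e_up_down : e_up <> e_down.
Proof. unfold e_up, e_down; intros H; injection H; lra. Qed.

(** Counterclockwise through (0,1) the coefficient passes from [a] to [b]. The shear subtracts
    [b - a] times the second column (-1,0) from the first, which changes just that entry. *)
Lemma cell_mat_jump_up a b t :
  cong t (/ 4) ->
  cell_mat a b (ccw_cell t) = mat_mul (cell_mat a b (cw_cell t)) (shear (b - a) e_up).
Proof.
  intros [z ->].
  rewrite (ccw_cell_unique (2 * z)), (cw_cell_unique (2 * (z - 1) + 1))
    by (rewrite ?plus_IZR, ?mult_IZR, ?minus_IZR; lra).
  unfold cell_mat; rewrite Z.even_even, Z.even_odd.
  apply mat_eq; simpl; ring.
Qed.

Lemma cell_mat_jump_down a b t :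
  cong t (3 / 4) ->
  cell_mat a b (ccw_cell t) = mat_mul (cell_mat a b (cw_cell t)) (shear (a - b) e_down).
Proof.
  intros [z ->].
  rewrite (ccw_cell_unique (2 * z + 1)), (cw_cell_unique (2 * z))
    by (rewrite ?plus_IZR, ?mult_IZR, ?minus_IZR; lra).
  unfold cell_mat; rewrite Z.even_even, Z.even_odd.
  apply mat_eq; simpl; ring.
Qed.

Lemma cell_mat_no_jump t : ~ on_axis t -> ccw_cell t = cw_cell t.
Proof.
  intros H; symmetry; apply cw_cell_unique.
  assert (B := ccw_cell_bounds t).
  assert (2 * t - / 2 <> IZR (ccw_cell t)); [|lra].
  intros e; exact (H (on_axis_intro _ _ e)).
Qed.

Lemma orbit_hit a b F r t n r' s :
  is_lift a b F -> 0 < r -> 0 < r' ->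
  Tn a b n (vscale r (dir t)) = vscale r' (dir s) -> cong (Nat.iter n F t) s.
Proof.
  intros HF Hr Hr' H; destruct (Tn_ray a b F r t n HF Hr) as [r2 [Hr2 e]].
  rewrite e in H; now apply dir_vscale_inj in H.
Qed.

(* The jumps at (0,1) and at (0,-1) are shears with opposite coefficients.  As these two
   vectors, and not merely their rays, lie on the orbit of u, conjugating by
   determinant-one maps carries both back to shears along u with those same
   coefficients. *)
Lemma one_sided_transfer a b F r t h1 h2 N :
  is_lift a b F -> circle_lift F -> aperiodic F -> 0 < r ->
  Tn a b h1 (vscale r (dir t)) = e_up -> Tn a b h2 (vscale r (dir t)) = e_down ->
  transfer a b ccw_cell F N t =
  mat_mul (transfer a b cw_cell F N t)
    (shear ((if (h1 <? N)%nat then b - a else 0) + (if (h2 <? N)%nat then a - b else 0))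
       (vscale r (dir t))).
Proof.
  intros HF HC HA Hr H1 H2; set (u := vscale r (dir t)) in *.
  assert (C1 : cong (Nat.iter h1 F t) (/ 4)).
  { apply (orbit_hit a b F r t h1 1); auto; [lra|now rewrite dir_up]. }
  assert (C2 : cong (Nat.iter h2 F t) (3 / 4)).
  { apply (orbit_hit a b F r t h2 1); auto; [lra|now rewrite dir_down]. }
  assert (h12 : h1 <> h2).
  { intros e; apply e_up_down; now rewrite <- H1, <- H2, e. }
  induction N as [|N IH].
  { simpl; rewrite mat_mul_id_l, Rplus_0_l, shear_0; auto. }
  set (p := Tn a b N u).
  set (d := (if (N =? h1)%nat then b - a else 0) + (if (N =? h2)%nat then a - b else 0)).
  assert (J : cell_mat a b (ccw_cell (Nat.iter N F t)) =
    mat_mul (cell_mat a b (cw_cell (Nat.iter N F t))) (shear d p)).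
  { unfold d; destruct (Nat.eqb_spec N h1) as [e1|e1].
    - destruct (Nat.eqb_spec N h2) as [e2|e2]; [congruence|].
      unfold p; rewrite Rplus_0_r, e1, H1; now apply cell_mat_jump_up.
    - destruct (Nat.eqb_spec N h2) as [e2|e2]; rewrite Rplus_0_l.
      + unfold p; rewrite e2, H2; now apply cell_mat_jump_down.
      + rewrite shear_0, mat_mul_id_r, cell_mat_no_jump; auto.
        (* A visit to the y-axis at any other time would repeat the direction at time [h1] or
           [h2]. *)
        intros [X|X].
        * apply e1, (aperiodic_index F _ _ t); auto.
          apply (cong_trans _ _ _ X); now apply cong_sym.
        * apply e2, (aperiodic_index F _ _ t); auto.
          apply (cong_trans _ _ _ X); now apply cong_sym. }
  set (c := (if (h1 <? N)%nat then b - a else 0) + (if (h2 <? N)%nat then a - b else 0)) in IH.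
  match goal with |- context [shear ?x u] => replace x with (d + c) end.
  - simpl transfer; rewrite J, IH, !mat_mul_assoc; f_equal.
    rewrite <- mat_mul_assoc.
    (* Seeing [p] as the image of [u] allows the new shear to be moved back through the first [N]
       steps and merged with the shear already along [u]. *)
    replace p with (mat_apply (transfer a b cw_cell F N t) u).
    + rewrite shear_conj, mat_mul_assoc, shear_add by apply transfer_det; reflexivity.
    + symmetry; apply transfer_apply; auto; apply cw_cell_selector.
  - unfold d, c.
    destruct (Nat.eqb_spec N h1), (Nat.eqb_spec N h2),
      (Nat.ltb_spec h1 N), (Nat.ltb_spec h2 N),
      (Nat.ltb_spec h1 (S N)), (Nat.ltb_spec h2 (S N)); try lia; lra.
Qed.

(** * Sectors and first returns *)

Lemma rot_dir th t : rot th (dir t) = dir (t + th / (2 * PI)).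
Proof.
  assert (HPI := PI_RGT_0); unfold rot, dir; simpl.
  replace (2 * PI * (t + th / (2 * PI))) with (th + 2 * PI * t) by (field; lra).
  rewrite cos_plus, sin_plus; reflexivity.
Qed.

Lemma rot_vscale th r p : rot th (vscale r p) = vscale r (rot th p).
Proof. unfold rot, vscale; simpl; f_equal; ring. Qed.

Lemma ccw_angle_dir r r' s t th :
  0 < r -> 0 < r' ->
  ccw_angle (vscale r (dir s)) (vscale r' (dir t)) th <->
  0 <= th < 2 * PI /\ cong t (s + th / (2 * PI)).
Proof.
  intros Hr Hr'; split.
  - intros [Hth [c [Hc e]]]; split; auto.
    rewrite rot_vscale, rot_dir, vscale_vscale in e.
    apply dir_vscale_inj in e; auto; [tauto|nra].
  - intros [Hth H]; split; auto; exists (r' / r).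
    split; [now apply Rdiv_lt_0_compat|].
    rewrite rot_vscale, rot_dir, vscale_vscale, (dir_cong _ _ H).
    f_equal; field; lra.
Qed.

Lemma ccw_angle_turn r r' s t th :
  0 < r -> 0 < r' ->
  ccw_angle (vscale r (dir s)) (vscale r' (dir t)) th ->
  0 <= th / (2 * PI) < 1 /\ cong t (s + th / (2 * PI)).
Proof.
  intros Hr Hr' H; apply ccw_angle_dir in H; auto; destruct H as [H C]; split; auto.
  assert (HPI := PI_RGT_0); split.
  - apply Rmult_le_pos; [lra|left; apply Rinv_0_lt_compat; lra].
  - apply (Rmult_lt_reg_r (2 * PI)); [lra|]; unfold Rdiv.
    rewrite Rmult_assoc, Rinv_l by lra; lra.
Qed.

Lemma ccw_angle_of_turn r r' s t x :
  0 < r -> 0 < r' -> 0 <= x < 1 -> cong t (s + x) ->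
  ccw_angle (vscale r (dir s)) (vscale r' (dir t)) (2 * PI * x).
Proof.
  intros Hr Hr' Hx H; assert (HPI := PI_RGT_0); apply ccw_angle_dir; auto.
  split; [nra|].
  now replace (2 * PI * x / (2 * PI)) with x by (field; lra).
Qed.

Lemma in_sector_dir r r' c al be t :
  0 < r -> 0 < r' -> 0 < c -> al < be < al + 1 ->
  in_sector (vscale r (dir al)) (vscale r' (dir be)) (vscale c (dir t)) <-> arc al be t.
Proof.
  intros Hr Hr' Hc Hab; assert (HPI := PI_RGT_0); split.
  - intros [th [th' [H [H' h]]]].
    apply ccw_angle_turn in H; auto; apply ccw_angle_turn in H'; auto.
    destruct H as [Hx C]; destruct H' as [Hx' C'].
    assert (L : th / (2 * PI) < th' / (2 * PI))
      by (apply Rmult_lt_compat_r; auto; apply Rinv_0_lt_compat; lra).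
    apply cong_close in C'; [|lra].
    destruct C as [z ->]; exists (- z)%Z; rewrite opp_IZR; lra.
  - intros [z Hz]; exists (2 * PI * (t + IZR z - al)), (2 * PI * (be - al)).
    split; [|split].
    + apply ccw_angle_of_turn; auto; [lra|].
      exists (- z)%Z; rewrite opp_IZR; lra.
    + apply ccw_angle_of_turn; auto; [lra|].
      exists 0%Z; simpl; lra.
    + apply Rmult_lt_compat_l; lra.
Qed.

Lemma in_open_sector_dir r r' c al be t :
  0 < r -> 0 < r' -> 0 < c -> al < be < al + 1 ->
  in_open_sector (vscale r (dir al)) (vscale r' (dir be)) (vscale c (dir t)) <->
  open_arc al be t.
Proof.
  intros Hr Hr' Hc Hab; assert (HPI := PI_RGT_0); split.
  - intros [th [th' [H [H' [h0 h]]]]].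
    apply ccw_angle_turn in H; auto; apply ccw_angle_turn in H'; auto.
    destruct H as [Hx C]; destruct H' as [Hx' C'].
    assert (L : th / (2 * PI) < th' / (2 * PI))
      by (apply Rmult_lt_compat_r; auto; apply Rinv_0_lt_compat; lra).
    assert (L0 : 0 < th / (2 * PI)) by (apply Rdiv_lt_0_compat; lra).
    apply cong_close in C'; [|lra].
    destruct C as [z ->]; exists (- z)%Z; rewrite opp_IZR; lra.
  - intros [z Hz]; exists (2 * PI * (t + IZR z - al)), (2 * PI * (be - al)).
    split; [|split; [|split]].
    + apply ccw_angle_of_turn; auto; [lra|].
      exists (- z)%Z; rewrite opp_IZR; lra.
    + apply ccw_angle_of_turn; auto; [lra|].
      exists 0%Z; simpl; lra.
    + apply Rmult_lt_0_compat; lra.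
    + apply Rmult_lt_compat_l; lra.
Qed.

Lemma in_sector_polar r r' al be w :
  0 < r -> 0 < r' -> al < be < al + 1 ->
  in_sector (vscale r (dir al)) (vscale r' (dir be)) w ->
  exists c t, 0 < c /\ w = vscale c (dir t) /\ al <= t < be.
Proof.
  intros Hr Hr' Hab Hw.
  assert (H : exists c t, 0 < c /\ w = vscale c (dir t)).
  { destruct Hw as [th [_ [[_ [c [Hc ->]]] _]]].
    exists (c * r), (al + th / (2 * PI)); split; [nra|].
    now rewrite rot_vscale, rot_dir, vscale_vscale. }
  destruct H as [c [t [Hc ->]]].
  apply in_sector_dir in Hw; auto; destruct Hw as [z Hz].
  exists c, (t + IZR z); repeat split; try lra.
  f_equal; apply dir_cong, cong_sym, cong_add.
Qed.

Lemma first_return_unique a b J w z z' :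
  first_return a b J w z -> first_return a b J w z' -> z = z'.
Proof.
  intros [k [Hk [Jk [Nk ->]]]] [k' [Hk' [Jk' [Nk' ->]]]].
  destruct (Nat.lt_trichotomy k k') as [h|[->|h]]; auto; exfalso.
  - apply (Nk' k); auto; lia.
  - apply (Nk k'); auto; lia.
Qed.

Lemma first_return_dir a b F r r' al be c t k :
  is_lift a b F -> 0 < r -> 0 < r' -> 0 < c -> al < be < al + 1 -> (1 <= k)%nat ->
  (forall i, (1 <= i < k)%nat -> ~ arc al be (Nat.iter i F t)) ->
  arc al be (Nat.iter k F t) ->
  first_return a b (in_sector (vscale r (dir al)) (vscale r' (dir be)))
    (vscale c (dir t)) (Tn a b k (vscale c (dir t))).
Proof.
  intros HF Hr Hr' Hc Hab Hk HN HJ.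
  assert (W : forall i, in_sector (vscale r (dir al)) (vscale r' (dir be))
      (Tn a b i (vscale c (dir t))) <-> arc al be (Nat.iter i F t)).
  { intros i; destruct (Tn_ray a b F c t i HF Hc) as [c' [Hc' ->]].
    now apply in_sector_dir. }
  exists k; split; [|split; [|split]]; auto.
  - now apply W.
  - intros j Hj Hs; apply (HN j); auto; now apply W.
Qed.

(** The segment is only known to contain the successors of the earlier point. Its first successor is
    the image of [v0] at some [j >= 1], so by injectivity of T the earlier point has index [j - 1],
    possibly 0. *)
Lemma opposite_points_hit a b v0 m :
  (exists k : Z, Tz a b k e_up = e_down) ->
  (forall k : Z, Tz a b k e_up = e_down ->
     ((0 < k)%Z -> forall i : Z, (0 < i <= k)%Z ->
        exists j : nat, (1 <= j <= m)%nat /\ Tz a b i e_up = Tn a b j v0) /\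
     ((k < 0)%Z -> forall i : Z, (0 < i <= - k)%Z ->
        exists j : nat, (1 <= j <= m)%nat /\ Tz a b i e_down = Tn a b j v0)) ->
  exists s s', (s <= m)%nat /\ (s' <= m)%nat /\
    Tn a b s v0 = e_up /\ Tn a b s' v0 = e_down.
Proof.
  intros [k Hk] H; destruct (H k Hk) as [Hp Hn].
  assert (D : forall e j, Tz a b 1 e = Tn a b j v0 -> (1 <= j <= m)%nat ->
    Tn a b (j - 1) v0 = e).
  { intros e j Hj Hm; replace j with (S (j - 1)) in Hj by lia.
    simpl in Hj; now apply T_inj in Hj. }
  destruct k as [|k|k].
  - now apply e_up_down in Hk.
  - destruct (Hp ltac:(lia) 1%Z ltac:(lia)) as [j [Hj e]].
    destruct (Hp ltac:(lia) (Z.pos k) ltac:(lia)) as [j' [Hj' e']].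
    exists (j - 1)%nat, j'; repeat split; try lia; [now apply D|congruence].
  - destruct (Hn ltac:(lia) 1%Z ltac:(lia)) as [j [Hj e]].
    destruct (Hn ltac:(lia) (Z.pos k) ltac:(lia)) as [j' [Hj' e']].
    exists j', (j - 1)%nat; repeat split; try lia; [|now apply D].
    rewrite <- e', <- Hk; simpl; apply Tn_Tinvn.
Qed.

Theorem theorem3p3 (a b : R) (v0 : vec) (m : nat) (v v' : vec) :
  (exists L : R, rotation_number a b L /\ irrational L) ->
  (exists k : Z, Tz a b k e_up = e_down) ->
  (* O = { T^(j)(v0) : 1 <= j <= m } contains the orbit points strictly
     between (0,1) and (0,-1) and the later of the two *)
  (forall k : Z, Tz a b k e_up = e_down ->
     ((0 < k)%Z -> forall i : Z, (0 < i <= k)%Z ->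
        exists j : nat, (1 <= j <= m)%nat /\ Tz a b i e_up = Tn a b j v0) /\
     ((k < 0)%Z -> forall i : Z, (0 < i <= - k)%Z ->
        exists j : nat, (1 <= j <= m)%nat /\ Tz a b i e_down = Tn a b j v0)) ->
  (exists j : nat, (1 <= j <= m)%nat /\ v = Tn a b j v0) ->
  (exists j : nat, (1 <= j <= m)%nat /\ v' = Tn a b j v0) ->
  ~ same_ray v v' ->
  (forall j : nat, (1 <= j <= m)%nat -> ~ in_open_sector v v' (Tn a b j v0)) ->
  exists (u : vec) (M1 M2 : mat),
    in_open_sector v v' u /\
    (forall w, in_sector v u w ->
       first_return a b (in_sector v v') w (mat_apply M1 w)) /\
    (forall w, in_sector u v' w ->
       first_return a b (in_sector v v') w (mat_apply M2 w)) /\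
    ~ (exists M : mat, forall w, in_sector v v' w ->
         first_return a b (in_sector v v') w (mat_apply M w)) /\
    mat_mul M1 M2 = mat_mul M2 M1.
Proof.
  intros [L [HL Hirr]] Hopp Hseg [p [Hp ev]] [q [Hq ev']] Hray Hopen.
  destruct (irrational_aperiodic a b L HL Hirr) as [F [HF [HC HA]]].
  destruct (opposite_points_hit a b v0 m Hopp Hseg) as [s [s' [Hs [Hs' [es es']]]]].
  clear L HL Hirr Hopp Hseg.
  assert (Hv0 : v0 <> (0, 0)).
  { intros e; rewrite e, Tn_zero in es; unfold e_up in es; injection es; lra. }
  destruct (polar v0 Hv0) as [r0 [x0 [Hr0 e0]]].
  destruct (Tn_ray a b F r0 x0 p HF Hr0) as [r [Hr er]].
  destruct (Tn_ray a b F r0 x0 q HF Hr0) as [r' [Hr' er']].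
  rewrite <- e0, <- ev in er; rewrite <- e0, <- ev' in er'.
  set (al := Nat.iter p F x0) in *.
  assert (Hbe : exists be, al < be < al + 1 /\ cong be (Nat.iter q F x0)).
  { set (y := Nat.iter q F x0) in *.
    destruct (base_Int_part (y - al)) as [b1 b2].
    exists (y + IZR (- Int_part (y - al))); split; [|apply cong_add].
    rewrite opp_IZR; split; [|lra].
    destruct (Rle_lt_or_eq_dec (IZR (Int_part (y - al))) (y - al) b1) as [l|l]; [lra|].
    exfalso; apply Hray; exists (r' / r); split; [now apply Rdiv_lt_0_compat|].
    rewrite er, er', vscale_vscale.
    replace (r' / r * r) with r' by (field; lra); f_equal.
    apply dir_cong; exists (Int_part (y - al)); lra. }
  destruct Hbe as [be [Hab Cbe]].
  rewrite <- (dir_cong _ _ Cbe) in er'.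
  assert (Hne : ~ cong al be).
  { intros C; apply cong_close in C; lra. }
  (* The case [n = 0] occurs when [v0] itself is interior to J: [Hopen] speaks only of indices from
     1 on. *)
  destruct (dec_inh_nat_subset_has_unique_least_element
    (fun n => exists y, al < y < be /\ cong (Nat.iter n F y) x0))
    as [n [[[ga [Hga Cga]] Hmin] _]].
  { intros n; apply classic. }
  { apply (backward_visit F al be p q x0); auto; try lia; try lra; apply cong_refl. }
  assert (Cn : forall j, cong (Nat.iter (j + n) F ga) (Nat.iter j F x0)).
  { intros j; rewrite Nat.iter_add; apply lift_cong; auto; now apply lift_iter. }
  (* The vector itself is kept, beyond its angle [ga], because its orbit must hit exactly (0,1) and
     (0,-1) for the shears to cancel. *)
  set (u := Tinvn a b n v0).
  assert (eu : Tn a b n u = v0) by apply Tn_Tinvn.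
  assert (Hu : u <> (0, 0)).
  { intros e; apply Hv0; now rewrite <- eu, e, Tn_zero. }
  destruct (polar u Hu) as [ru [gu [Hru eru]]].
  assert (Cu : cong gu ga).
  { apply (lift_cong_inv (Nat.iter n F)); [now apply lift_iter|].
    apply (cong_trans _ x0); [|now apply cong_sym].
    apply (orbit_hit a b F ru gu n r0); auto; now rewrite <- eru, eu. }
  rewrite (dir_cong _ _ Cu) in eru; clear gu Cu Hu.
  assert (Tu : forall j, Tn a b (j + n) u = Tn a b j v0).
  { intros j; now rewrite Tn_add, eu. }
  set (P := (p + n)%nat); set (Q := (q + n)%nat); set (M := (m + n)%nat).
  assert (HP : (1 <= P <= M)%nat) by (unfold P, M; lia).
  assert (HQ : (1 <= Q <= M)%nat) by (unfold Q, M; lia).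
  assert (CP : cong (Nat.iter P F ga) al) by apply Cn.
  assert (CQ : cong (Nat.iter Q F ga) be).
  { apply (cong_trans _ _ _ (Cn q)); now apply cong_sym. }
  (* Up to time [n] an interior visit would contradict the minimality of [n]; after that the orbit
     runs along the given segment. *)
  assert (HM : forall i, (1 <= i <= M)%nat -> ~ open_arc al be (Nat.iter i F ga)).
  { intros i Hi Ho; destruct (Nat.le_gt_cases i n) as [h|h].
    - destruct Ho as [z Hz].
      assert (n <= n - i)%nat; [|lia].
      apply Hmin; exists (Nat.iter i F ga + IZR z); split; auto.
      rewrite (lift_shift _ (lift_iter F (n - i) HC)).
      apply (cong_trans _ _ _ (cong_add _ _)).
      rewrite <- Nat.iter_add; now replace (n - i + i)%nat with n by lia.
    - apply (Hopen (i - n)%nat); [unfold M in Hi; lia|].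
      destruct (Tn_ray a b F r0 x0 (i - n) HF Hr0) as [ri [Hri eri]].
      rewrite e0, eri, er, er'; apply in_open_sector_dir; auto.
      apply (open_arc_cong _ _ (Nat.iter i F ga)); auto.
      assert (C := Cn (i - n)%nat); now replace (i - n + n)%nat with i in C by lia. }
  assert (Hpq := return_time_sum F al be ga M P Q HC HA (proj2 Hab) Hga HM HP CP HQ CQ).
  assert (Hup : Tn a b (s + n) u = e_up) by now rewrite Tu.
  assert (Hdown : Tn a b (s' + n) u = e_down) by now rewrite Tu.
  rewrite eru in Hup, Hdown.
  assert (Cup : cong (Nat.iter (s + n) F ga) (/ 4)).
  { apply (orbit_hit a b F ru ga _ 1); auto; [lra|now rewrite dir_up]. }
  assert (Cdown : cong (Nat.iter (s' + n) F ga) (3 / 4)).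
  { apply (orbit_hit a b F ru ga _ 1); auto; [lra|now rewrite dir_down]. }
  assert (Hoff : forall R t i, al < t < be -> t <> ga ->
    (forall i, (1 <= i < R)%nat -> ~ arc al be (Nat.iter i F t)) -> (i < R)%nat ->
    ~ on_axis (Nat.iter i F t)).
  { intros R t i Ht Htg HR Hi [C|C].
    - apply (avoids_before_return F al be ga M R t i (s + n)); auto; try lra.
      + unfold M; lia.
      + apply (cong_trans _ _ _ C); now apply cong_sym.
    - apply (avoids_before_return F al be ga M R t i (s' + n)); auto; try lra.
      + unfold M; lia.
      + apply (cong_trans _ _ _ C); now apply cong_sym. }
  assert (HL : forall t, al <= t < ga ->
    (forall i, (1 <= i < Q)%nat -> ~ arc al be (Nat.iter i F t)) /\
    arc al be (Nat.iter Q F t)).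
  { intros t Ht; apply (left_return F al be ga M P Q t); auto; lra. }
  assert (HR : forall t, ga <= t < be ->
    (forall i, (1 <= i < P)%nat -> ~ arc al be (Nat.iter i F t)) /\
    arc al be (Nat.iter P F t)).
  { intros t Ht; apply (right_return F al be ga M P Q t); auto; lra. }
  assert (TL : forall t, al <= t < ga ->
    transfer a b ccw_cell F Q al = transfer a b cw_cell F Q ga /\
    transfer a b ccw_cell F Q t = transfer a b ccw_cell F Q al).
  { intros t Ht; apply off_axis_transfer; auto; [lra|].
    intros y i Hy Hi; apply (Hoff Q); auto; try lra.
    apply HL; lra. }
  assert (TR : forall t, ga <= t < be ->
    transfer a b ccw_cell F P ga = transfer a b cw_cell F P be /\
    transfer a b ccw_cell F P t = transfer a b ccw_cell F P ga).
  { intros t Ht; apply off_axis_transfer; auto; [lra|].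
    intros y i Hy Hi; apply (Hoff P); auto; try lra.
    apply HR; lra. }
  set (M1 := transfer a b ccw_cell F Q al) in *.
  set (M2 := transfer a b ccw_cell F P ga) in *.
  assert (S1 := ccw_cell_selector); assert (S2 := cw_cell_selector).
  assert (R1 : forall c t, 0 < c -> al <= t < ga ->
    first_return a b (in_sector v v') (vscale c (dir t)) (mat_apply M1 (vscale c (dir t)))).
  { intros c t Hc Ht; rewrite <- (proj2 (TL t Ht)), er, er'.
    rewrite <- (transfer_apply a b ccw_cell F Q c t) by auto.
    destruct (HL t Ht); apply (first_return_dir a b F); auto; lia. }
  assert (R2 : forall c t, 0 < c -> ga <= t < be ->
    first_return a b (in_sector v v') (vscale c (dir t)) (mat_apply M2 (vscale c (dir t)))).
  { intros c t Hc Ht; rewrite <- (proj2 (TR t Ht)), er, er'.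
    rewrite <- (transfer_apply a b ccw_cell F P c t) by auto.
    destruct (HR t Ht); apply (first_return_dir a b F); auto; lia. }
  exists u, M1, M2; split; [|split; [|split; [|split]]].
  - rewrite er, er', eru; apply in_open_sector_dir; auto.
    exists 0%Z; simpl; lra.
  - intros w Hw; rewrite er, eru in Hw.
    apply in_sector_polar in Hw; auto; [|lra].
    destruct Hw as [c [t [Hc [-> Ht]]]]; auto.
  - intros w Hw; rewrite er', eru in Hw.
    apply in_sector_polar in Hw; auto; [|lra].
    destruct Hw as [c [t [Hc [-> Ht]]]]; auto.
  - intros [N HN].
    assert (SN : forall t, al <= t < be ->
      first_return a b (in_sector v v') (vscale 1 (dir t)) (mat_apply N (vscale 1 (dir t)))).
    { intros t Ht; apply HN; rewrite er, er'; apply in_sector_dir; auto; [lra|].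
      exists 0%Z; simpl; lra. }
    (* A second direction in the left piece, less than half a turn from [al]; the two form a basis
       and determine the matrix. *)
    set (t1 := al + (ga - al) / 3).
    assert (EN : N = M1).
    { apply (mat_eq_on_basis N M1 (vscale 1 (dir al)) (vscale 1 (dir t1))).
      - rewrite vdet_vscale, vdet_dir.
        assert (0 < sin (2 * PI * (t1 - al))); [|lra].
        assert (HPI := PI_RGT_0); apply sin_gt_0; unfold t1; nra.
      - apply (first_return_unique a b (in_sector v v') (vscale 1 (dir al)));
          [apply SN|apply R1]; lra.
      - apply (first_return_unique a b (in_sector v v') (vscale 1 (dir t1)));
          [apply SN|apply R1]; unfold t1; lra. }
    (* With a single matrix, T^Q and T^P would agree on the ray of [u], although they send it to the
       two different ends of J. *)
    assert (EU : mat_apply M1 (vscale 1 (dir ga)) = mat_apply M2 (vscale 1 (dir ga))).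
    { rewrite <- EN.
      apply (first_return_unique a b (in_sector v v') (vscale 1 (dir ga)));
        [apply SN|apply R2]; lra. }
    rewrite (proj1 (TL al ltac:(lra))) in EU; unfold M2 in EU.
    rewrite <- !transfer_apply in EU by (auto; lra).
    destruct (Tn_ray a b F 1 ga Q HF Rlt_0_1) as [c1 [Hc1 e1]].
    rewrite e1 in EU; symmetry in EU; apply (orbit_hit a b F 1 ga P c1) in EU; auto; [|lra].
    apply Hne, (cong_trans _ _ _ (cong_sym _ _ CP)), (cong_trans _ _ _ EU), CQ.
  - transitivity (transfer a b ccw_cell F (P + Q) ga).
    + rewrite Nat.add_comm, transfer_add; fold M2; f_equal.
      apply transfer_cong; auto; now apply cong_sym.
    + rewrite (one_sided_transfer a b F ru ga (s + n) (s' + n)) by auto.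
      destruct (Nat.ltb_spec (s + n) (P + Q)); [|unfold M in Hpq; lia].
      destruct (Nat.ltb_spec (s' + n) (P + Q)); [|unfold M in Hpq; lia].
      replace (b - a + (a - b)) with 0 by ring.
      rewrite shear_0, mat_mul_id_r, transfer_add.
      rewrite (proj1 (TL al ltac:(lra))); f_equal.
      rewrite (proj1 (TR ga ltac:(lra))); apply transfer_cong; auto.
Qed.
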